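(* (1) Every right coherent ring is left GF-closed. (2) Every ring with finite weak dimension is left GF-closed.
   Context: All rings are associative with identity and all modules are unitary. A ring $R$ is right coherent if every finitely generated right ideal $I$ is finitely presented, i.e. there is an exact sequence of right $R$-modules $F_1\to F_0\to I\to 0$ with $F_0,F_1$ finitely generated free. The weak dimension of $R$ is the supremum of the flat dimensions of all $R$-modules. A left $R$-module $M$ is Gorenstein flat if there exists an exact sequence of flat left $R$-modules $\cdots\to F_1\to F_0\to F^0\to F^1\to\cdots$ such that $M\cong \mathrm{Im}(F_0\to F^0)$ and such that $I\otimes_R -$ leaves the sequence exact whenever $I$ is an injective right $R$-module. A ring $R$ is left GF-closed if the class of Gorenstein flat left $R$-modules is closed under extensions: for every short exact sequence of left $R$-modules $0\to A\to B\to C\to 0$ with $A$ and $C$ Gorenstein flat, $B$ is Gorenstein flat. *)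

(* Defs.v *)
From HB Require Import structures.
From mathcomp Require Import all_boot all_order all_algebra.
From mathcomp Require Import boolp.

Set Implicit Arguments.
Unset Strict Implicit.
Unset Printing Implicit Defensive.

Import GRing.Theory.
Local Open Scope ring_scope.
Local Open Scope quotient_scope.

(* Rings are [pzRingType]s: associative with 1, not assumed commutative, and
   possibly zero.  Left modules are [lmodType R].  Right modules are left
   modules over the converse ring, the right action x . r being
   [(r : R^c) *: x]. *)
Notation rmodType R := (lmodType R^c).

Definition surj (A B : Type) (f : A -> B) : Prop := forall y, exists x, f x = y.

(* Exactness of A -f-> B -g-> C at B: Ker g = Im f. *)
Definition exact_at (A B C : zmodType) (f : A -> B) (g : B -> C) : Prop :=
  forall y, g y = 0 <-> exists x, f x = y.

Definition short_exact (A B C : zmodType) (f : A -> B) (g : B -> C) : Prop :=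
  [/\ injective f, exact_at f g & surj g].

(* Exactness of
   ... -> L 1 -l 0-> L 0 -t-> U 0 -u 0-> U 1 -> ...
   at every term; L n is F_n and U n is F^n. *)
Definition doubly_exact (L U : nat -> zmodType)
    (l : forall n, L n.+1 -> L n) (t : L 0%N -> U 0%N)
    (u : forall n, U n -> U n.+1) : Prop :=
  [/\ forall n, exact_at (l n.+1) (l n),
      exact_at (l 0%N) t,
      exact_at t (u 0%N)
    & forall n, exact_at (u n) (u n.+1)].

(* The tensor product A (x)_R M of a right and a left R-module.  A sequence
   [:: (a1, m1); ...; (ak, mk)] stands for a1 (x) m1 + ... + ak (x) mk, and
   these formal sums are divided by the least congruence making addition
   commutative and (x) biadditive and R-balanced.  No formal negatives are
   needed, as (- a) (x) m is opposite to a (x) m by biadditivity. *)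
Section Tensor.
Variables (R : pzRingType) (A : rmodType R) (M : lmodType R).

Inductive tensor_eq : seq (A * M) -> seq (A * M) -> Prop :=
| TensorRefl s : tensor_eq s s
| TensorSym s t : tensor_eq s t -> tensor_eq t s
| TensorTrans s t u : tensor_eq s t -> tensor_eq t u -> tensor_eq s u
| TensorCat s s' t t' :
    tensor_eq s s' -> tensor_eq t t' -> tensor_eq (s ++ t) (s' ++ t')
| TensorComm s t : tensor_eq (s ++ t) (t ++ s)
| TensorZero m : tensor_eq [:: (0, m)] [::]
| TensorAddl a a' m : tensor_eq [:: (a + a', m)] [:: (a, m); (a', m)]
| TensorAddr a m m' : tensor_eq [:: (a, m + m')] [:: (a, m); (a, m')]
| TensorBal a (r : R) m :
    tensor_eq [:: ((r : R^c) *: a, m)] [:: (a, r *: m)].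

Definition tensor_eqb : rel (seq (A * M)) := fun s t => `[< tensor_eq s t >].

Lemma tensor_eqb_equiv : equiv_class_of tensor_eqb.
Proof.
split=> [s|s t|t s u].
- by apply/asboolP; apply: TensorRefl.
- by apply/asboolP/asboolP; apply: TensorSym.
- move=> /asboolP st /asboolP tu; apply/asboolP; exact: TensorTrans st tu.
Qed.

Canonical tensor_equiv_rel := EquivRelPack tensor_eqb_equiv.
Canonical tensor_encModRel := defaultEncModRel tensor_eqb.

Definition tensor : Type := {eq_quot tensor_eqb}.

HB.instance Definition _ : EqQuotient _ tensor_eqb tensor :=
  EqQuotient.on tensor.
HB.instance Definition _ := Choice.on tensor.

Definition tensor_of (s : seq (A * M)) : tensor := \pi_tensor s.

Lemma tensor_ofP s t : tensor_of s = tensor_of t <-> tensor_eq s t.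
Proof.
split=> [/eqP|st]; first by rewrite eqmodE => /asboolP.
by apply/eqP; rewrite eqmodE; apply/asboolP.
Qed.

Lemma tensor_reprK x : tensor_of (repr x) = x.
Proof. exact: reprK. Qed.

Lemma tensor_repr_of s : tensor_eq (repr (tensor_of s)) s.
Proof. by apply/tensor_ofP; rewrite tensor_reprK. Qed.

Definition tensor_add (x y : tensor) := tensor_of (repr x ++ repr y).
Definition tensor_opp (x : tensor) :=
  tensor_of [seq (- p.1, p.2) | p <- repr x].

Lemma tensor_addE s t :
  tensor_add (tensor_of s) (tensor_of t) = tensor_of (s ++ t).
Proof. by apply/tensor_ofP/TensorCat; apply: tensor_repr_of. Qed.

Lemma tensor_oppl s : tensor_eq ([seq (- p.1, p.2) | p <- s] ++ s) [::].
Proof.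
elim: s => [|[a m] s IHs] /=; first exact: TensorRefl.
have am0 : tensor_eq [:: (- a, m); (a, m)] [::].
  apply: TensorTrans (TensorZero m).
  by apply: TensorSym; rewrite -(addNr a); apply: TensorAddl.
apply: (TensorTrans (t := [:: (- a, m); (a, m)] ++
                          ([seq (- p.1, p.2) | p <- s] ++ s))).
  apply: (TensorCat (s := [:: (- a, m)]) (s' := [:: (- a, m)])).
    exact: TensorRefl.
  rewrite -(cat1s (a, m) s) -(cat1s (a, m) (_ ++ s)) !catA.
  by apply: TensorCat; [apply: TensorComm | apply: TensorRefl].
exact: TensorCat am0 IHs.
Qed.

Lemma tensor_addA : associative tensor_add.
Proof.
move=> x y z; rewrite -(tensor_reprK x) -(tensor_reprK y) -(tensor_reprK z).
by rewrite !tensor_addE catA.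
Qed.

Lemma tensor_addC : commutative tensor_add.
Proof. by move=> x y; apply/tensor_ofP/TensorComm. Qed.

Lemma tensor_add0 : left_id (tensor_of [::]) tensor_add.
Proof. by move=> x; rewrite -(tensor_reprK x) tensor_addE. Qed.

Lemma tensor_addN : left_inverse (tensor_of [::]) tensor_opp tensor_add.
Proof.
move=> x; rewrite -{2}(tensor_reprK x) tensor_addE.
exact/tensor_ofP/tensor_oppl.
Qed.

HB.instance Definition _ :=
  GRing.isZmodule.Build tensor tensor_addA tensor_addC tensor_add0 tensor_addN.

End Tensor.

(* f (x) g : a (x) m |-> f a (x) g m. *)
Definition tensor_map (R : pzRingType) (A B : rmodType R) (M N : lmodType R)
    (f : {linear A -> B}) (g : {linear M -> N}) (x : tensor A M) : tensor B N :=
  tensor_of [seq (f p.1, g p.2) | p <- repr x].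

(* The functor - (x)_R M is exact. *)
Definition flat (R : pzRingType) (M : lmodType R) : Prop :=
  forall (A B C : rmodType R) (f : {linear A -> B}) (g : {linear B -> C}),
    short_exact f g ->
    short_exact (tensor_map f (idfun : {linear M -> M}))
                (tensor_map g (idfun : {linear M -> M})).

Definition injective_module (S : pzRingType) (E : lmodType S) : Prop :=
  forall (A B : lmodType S) (i : {linear A -> B}) (f : {linear A -> E}),
    injective i -> exists g : {linear B -> E}, forall x, g (i x) = f x.

(* The isomorphism of M with Im (F_0 -> F^0) is given as an injective linear
   map j from M to F^0 with the same image as F_0 -> F^0. *)
Definition gorenstein_flat (R : pzRingType) (M : lmodType R) : Prop :=
  exists (L U : nat -> lmodType R)
         (l : forall n, {linear L n.+1 -> L n})
         (t : {linear L 0%N -> U 0%N})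
         (u : forall n, {linear U n -> U n.+1}),
  [/\ (forall n, flat (L n)) /\ (forall n, flat (U n)),
      doubly_exact (fun n => l n) t (fun n => u n),
      exists j : {linear M -> U 0%N},
        injective j /\
        forall y, (exists x, j x = y) <-> (exists x, t x = y)
    & forall I : rmodType R, injective_module I ->
        doubly_exact (fun n => tensor_map (idfun : {linear I -> I}) (l n))
                     (tensor_map (idfun : {linear I -> I}) t)
                     (fun n => tensor_map (idfun : {linear I -> I}) (u n))].

Definition left_GF_closed (R : pzRingType) : Prop :=
  forall (A B C : lmodType R) (f : {linear A -> B}) (g : {linear B -> C}),
    short_exact f g ->
    gorenstein_flat A -> gorenstein_flat C -> gorenstein_flat B.

Definition submodule (S : pzRingType) (V : lmodType S) (J : submodClosed V) :=
  {x : V | x \in J}.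

HB.instance Definition _ (S : pzRingType) (V : lmodType S)
    (J : submodClosed V) := SubChoice.on (submodule J).
HB.instance Definition _ (S : pzRingType) (V : lmodType S)
    (J : submodClosed V) := [SubChoice_isSubLmodule of submodule J by <:].

Definition finitely_generated (S : pzRingType) (M : lmodType S) : Prop :=
  exists (n : nat) (e : 'I_n -> M),
    forall x, exists c : 'I_n -> S, x = \sum_i c i *: e i.

Definition fg_free (S : pzRingType) (F : lmodType S) : Prop :=
  exists (n : nat) (f : {linear 'rV[S]_n -> F}), bijective f.

Definition finitely_presented (S : pzRingType) (M : lmodType S) : Prop :=
  exists (F1 F0 : lmodType S) (d : {linear F1 -> F0}) (p : {linear F0 -> M}),
    [/\ fg_free F1, fg_free F0, exact_at d p & surj p].

(* Right ideals are the submodules of the right module R_R, which is the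
   regular module [R^c^o]. *)
Definition right_coherent (R : pzRingType) : Prop :=
  forall J : submodClosed (R^c^o : rmodType R),
    finitely_generated (submodule J) -> finitely_presented (submodule J).

(* fd M <= n: there is an exact sequence 0 -> F_n -> ... -> F_0 -> M -> 0 of
   flat modules, written as an infinite one that vanishes beyond n. *)
Definition flat_dim_le (R : pzRingType) (n : nat) (M : lmodType R) : Prop :=
  exists (F : nat -> lmodType R) (d : forall i, {linear F i.+1 -> F i})
         (p : {linear F 0%N -> M}),
    [/\ (forall i, flat (F i)) /\ (forall i, (n < i)%N -> forall x : F i, x = 0),
        (forall i, exact_at (d i.+1) (d i)),
        exact_at (d 0%N) p
      & surj p].

(* The weak dimension, the supremum of the flat dimensions of the left
   modules, is finite.  Taking right modules gives the same supremum. *)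
Definition finite_weak_dim (R : pzRingType) : Prop :=
  exists n : nat, forall M : lmodType R, flat_dim_le n M.

(* Main.v *)
From HB Require Import structures.
From mathcomp Require Import all_boot all_order all_algebra.
From mathcomp Require Import boolp classical_sets functions.
Require Import Defs.

(** Write T(M) for the property that Tor_k(I, M) = 0 for all k > 0 and all
    injective right modules I.  A module M is Gorenstein flat as soon as it
    lies in a class X of modules satisfying T, each of which embeds into a
    flat module with cokernel again in X: iterating the embeddings gives the
    right half of a complete resolution of M, a free resolution gives the
    left half, and Tor vanishing keeps both exact under I (x) -
    ([gorenstein_flat_coind]).  Conversely Gorenstein flat modules satisfy T
    and have Gorenstein flat cosyzygies.

    Coherent rings.  Let X be the class of iterated extensions of Gorenstein
    flat modules; it satisfies T, because T passes to extensions.  Given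
    0 -> A -> B -> C -> 0 in X with embeddings A -> F and C -> F' into flat
    modules, with cokernels A' and C' in X, one would like to extend A -> F
    to B.  This is possible after replacing F by its character bidual F^++,
    where M^+ = Hom_Z(M, Q/Z): extending a map into (F^+)^+ along A -> B
    amounts to extending a character along F^+ (x) A -> F^+ (x) B, which is
    injective because F^+ is injective and Tor_1(F^+, C) = 0
    ([rdual_extend]).  Coherence enters only to say that F^++ is flat
    ([coherent_rdual_flat]).  As F -> F^++ is pure, F^++/F is flat too, so
    A'' = F^++/A, an extension of F^++/F by A', stays in X
    ([nested_coker]); then B embeds into F^++ x F' with cokernel an extension
    of C' by A'' ([horseshoe]).  Hence X consists of Gorenstein flat modules.

    Finite weak dimension n.  A Gorenstein flat module is the n-th syzygy,
    through flat modules, of its n-th cosyzygy; the latter has flat dimension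
    at most n, so the former is flat by dimension shifting.  Flat modules are
    Gorenstein flat and closed under extensions.

    Higher Tor groups are avoided by shifting in the right-hand variable:
    Tor_{k+1}(I, M) = Tor_1(J, M) for J a k-th syzygy of I, and the vanishing
    of Tor_1 is a statement about injectivity of maps between tensor
    products, which can be tested on a free module mapping onto either variable
    ([grid_chase]). *)

Set Implicit Arguments.
Unset Strict Implicit.
Unset Printing Implicit Defensive.

Import Order.TTheory GRing.Theory Num.Theory.
Local Open Scope ring_scope.
Local Open Scope quotient_scope.

(** * Linear relations, submodules, cokernels and Baer's criterion *)
Definition linear_of (S : pzRingType) (U V : lmodType S) (f : U -> V)
    (Hf : linear f) : {linear U -> V} :=
  HB.pack f (GRing.isLinear.Build S U V *:%R f Hf).

Definition additive_of (U V : zmodType) (f : U -> V)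
    (Hf : zmod_morphism f) : {additive U -> V} :=
  HB.pack f (GRing.isZmodMorphism.Build U V f Hf).

(** Partial linear maps are handled as linear relations.  This keeps their
    domains, and the ideals of Baer's criterion, out of the types. *)
Definition linear_rel (S : pzRingType) (V W : lmodType S)
    (G : V -> W -> Prop) :=
  G 0 0 /\ forall a x y u v, G x u -> G y v -> G (a *: x + y) (a *: u + v).

Definition functional_rel (V W : zmodType) (G : V -> W -> Prop) :=
  forall u, G 0 u -> u = 0.

Section LinearRelations.
Variables (S : pzRingType) (V W : lmodType S) (G : V -> W -> Prop).
Hypotheses (Glin : linear_rel G) (Gfun : functional_rel G).

Lemma linear_rel_sub x y u v : G x u -> G y v -> G (x - y) (u - v).
Proof.
move=> Gx Gy; rewrite -!scaleN1r addrC [u + _]addrC.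
by case: Glin => _; apply.
Qed.

Lemma linear_relZ a x u : G x u -> G (a *: x) (a *: u).
Proof.
case: Glin => G0 GD Gx.
by rewrite -[a *: x]addr0 -[a *: u]addr0; apply: GD.
Qed.

Lemma functional_rel_uniq x u v : G x u -> G x v -> u = v.
Proof.
move=> Gu Gv; apply/eqP; rewrite -subr_eq0; apply/eqP/Gfun.
by rewrite -(subrr x); apply: linear_rel_sub.
Qed.

(** The usual way below to define a linear map by choosing preimages. *)
Lemma linear_of_rel : (forall x, exists u, G x u) ->
  exists f : {linear V -> W}, forall x, G x (f x).
Proof.
move=> Gtot; have [f Gf] := choice Gtot.
have flin : linear f.
  move=> a x y; apply: functional_rel_uniq (Gf _) _.
  by case: Glin => _; apply.
by exists (linear_of flin) => x; apply: Gf.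
Qed.

End LinearRelations.

Section Factor.
Variable S : pzRingType.

Lemma factor_surj (V W Z : lmodType S) (p : {linear V -> W})
    (h : {linear V -> Z}) : surj p -> (forall x, p x = 0 -> h x = 0) ->
  exists k : {linear W -> Z}, forall x, k (p x) = h x.
Proof.
move=> p_surj ker_ph.
pose G (w : W) (z : Z) := exists x, w = p x /\ z = h x.
have Glin : linear_rel G.
  split=> [|a _ _ _ _ [x [-> ->]] [y [-> ->]]].
    by exists 0; rewrite !linear0.
  by exists (a *: x + y); rewrite !linearP.
have Gfun : functional_rel G by move=> _ [x [/esym/ker_ph hx ->]].
have [w|k Gk] := linear_of_rel Glin Gfun.
  by have [x <-] := p_surj w; exists (h x); exists x.
by exists k => x; apply: (functional_rel_uniq Glin Gfun (Gk _)); exists x.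
Qed.

Lemma factor_inj (A V Z : lmodType S) (i : {linear A -> V})
    (h : {linear Z -> V}) : injective i -> (forall z, exists a, i a = h z) ->
  exists k : {linear Z -> A}, forall z, i (k z) = h z.
Proof.
move=> i_inj im_h; pose G (z : Z) (a : A) := i a = h z.
have Glin : linear_rel G.
  split=> [|a x y u v Gx Gy]; rewrite /G ?linear0 //.
  by rewrite !linearP Gx Gy.
apply: linear_of_rel Glin _ im_h => a.
by rewrite /G linear0 => ia0; apply: i_inj; rewrite linear0.
Qed.

End Factor.

Section PropSubmodule.
Variables (S : pzRingType) (V : lmodType S) (P : V -> Prop).
Hypotheses (P0 : P 0) (PD : forall a x y, P x -> P y -> P (a *: x + y)).

Definition prop_pred : {pred V} := fun x => `[< P x >].

Lemma prop_pred_closed : subsemimod_closed prop_pred.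
Proof.
split; last first.
  move=> a x /asboolP Px; apply/asboolP.
  by rewrite -[_ *: x]addr0; apply: PD.
split=> [|x y /asboolP Px /asboolP Py]; first exact/asboolP.
by apply/asboolP; rewrite -[x]scale1r; apply: PD.
Qed.

Definition prop_submod : submodClosed V :=
  HB.pack prop_pred
    (GRing.isSubmodClosed.Build S V prop_pred prop_pred_closed).

Lemma prop_submodE x : (x \in prop_submod) <-> P x.
Proof. by split=> /asboolP. Qed.

End PropSubmodule.

Lemma exists_kernel (S : pzRingType) (V W : lmodType S) (g : {linear V -> W}) :
  exists (K : lmodType S) (i : {linear K -> V}), injective i /\ exact_at i g.
Proof.
have ker0 : g 0 = 0 by rewrite linear0.
have kerD a x y : g x = 0 -> g y = 0 -> g (a *: x + y) = 0.
  by rewrite linearP => -> ->; rewrite scaler0 addr0.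
pose J := prop_submod ker0 kerD.
exists (submodule J), (val : {linear submodule J -> V}).
split=> [|y]; first exact: val_inj.
split=> [gy|[[x xJ] <-]]; last exact/(prop_submodE ker0 kerD).
have yJ : y \in J by apply/(prop_submodE ker0 kerD).
by exists (exist _ y yJ).
Qed.

Section Cokernel.
Variables (S : pzRingType) (A V : lmodType S) (i : {linear A -> V}).

(** The cokernel is the quotient of V by congruence modulo the image of i. *)
Definition coker_eqb : rel V := fun x y => `[< exists a, i a = x - y >].

Lemma coker_eqb_equiv : equiv_class_of coker_eqb.
Proof.
split=> [x|x y|y x z].
- by apply/asboolP; exists 0; rewrite linear0 subrr.
- by apply/asboolP/asboolP=> -[a ia]; exists (- a); rewrite linearN ia opprB.
- move=> /asboolP[a ia] /asboolP[b ib]; apply/asboolP; exists (a + b).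
  by rewrite linearD ia ib addrA subrK.
Qed.

Canonical coker_equiv_rel := EquivRelPack coker_eqb_equiv.
Canonical coker_encModRel := defaultEncModRel coker_eqb.

Definition coker : Type := {eq_quot coker_eqb}.

HB.instance Definition _ : EqQuotient _ coker_eqb coker := EqQuotient.on coker.
HB.instance Definition _ := Choice.on coker.

Definition coker_of (x : V) : coker := \pi_coker x.

Lemma coker_ofP x y : coker_of x = coker_of y <-> exists a, i a = x - y.
Proof.
split=> [/eqP|xy]; first by rewrite eqmodE => /asboolP.
by apply/eqP; rewrite eqmodE; apply/asboolP.
Qed.

Lemma coker_reprK (x : coker) : coker_of (repr x) = x.
Proof. exact: reprK. Qed.

Lemma coker_repr_of x : exists a, i a = repr (coker_of x) - x.
Proof. by apply/coker_ofP; rewrite coker_reprK. Qed.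

Definition coker_add (x y : coker) : coker := coker_of (repr x + repr y).
Definition coker_opp (x : coker) : coker := coker_of (- repr x).
Definition coker_scale (a : S) (x : coker) : coker := coker_of (a *: repr x).

Lemma coker_addE x y : coker_add (coker_of x) (coker_of y) = coker_of (x + y).
Proof.
apply/coker_ofP; have [a ia] := coker_repr_of x; have [b ib] := coker_repr_of y.
by exists (a + b); rewrite linearD ia ib opprD addrACA.
Qed.

Lemma coker_oppE x : coker_opp (coker_of x) = coker_of (- x).
Proof.
apply/coker_ofP; have [a ia] := coker_repr_of x.
by exists (- a); rewrite linearN ia opprB opprK addrC.
Qed.

Lemma coker_scaleE a x : coker_scale a (coker_of x) = coker_of (a *: x).
Proof.
apply/coker_ofP; have [b ib] := coker_repr_of x.
by exists (a *: b); rewrite linearZ /= ib scalerBr.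
Qed.

Lemma coker_addA : associative coker_add.
Proof.
move=> x y z; rewrite -(coker_reprK x) -(coker_reprK y) -(coker_reprK z).
by rewrite !coker_addE addrA.
Qed.

Lemma coker_addC : commutative coker_add.
Proof. by move=> x y; rewrite /coker_add addrC. Qed.

Lemma coker_add0 : left_id (coker_of 0) coker_add.
Proof. by move=> x; rewrite -(coker_reprK x) coker_addE add0r. Qed.

Lemma coker_addN : left_inverse (coker_of 0) coker_opp coker_add.
Proof.
by move=> x; rewrite -(coker_reprK x) coker_oppE coker_addE addNr.
Qed.

HB.instance Definition _ :=
  GRing.isZmodule.Build coker coker_addA coker_addC coker_add0 coker_addN.

Lemma coker_ofD x y : coker_of (x + y) = coker_of x + coker_of y.
Proof. by symmetry; apply: coker_addE. Qed.

Lemma coker_scaleA a b x :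
  coker_scale a (coker_scale b x) = coker_scale (a * b) x.
Proof. by rewrite -(coker_reprK x) !coker_scaleE scalerA. Qed.

Lemma coker_scale1 : left_id 1 coker_scale.
Proof. by move=> x; rewrite -(coker_reprK x) coker_scaleE scale1r. Qed.

Lemma coker_scaleDr : right_distributive coker_scale +%R.
Proof.
move=> a x y; rewrite -(coker_reprK x) -(coker_reprK y).
by rewrite -coker_ofD !coker_scaleE scalerDr coker_ofD.
Qed.

Lemma coker_scaleDl x : {morph coker_scale^~ x : a b / a + b}.
Proof.
move=> a b; rewrite -(coker_reprK x).
by rewrite !coker_scaleE scalerDl coker_ofD.
Qed.

HB.instance Definition _ := GRing.Zmodule_isLmodule.Build S coker
  coker_scaleA coker_scale1 coker_scaleDr coker_scaleDl.

Lemma coker_of_linear : linear coker_of.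
Proof.
move=> a x y; have -> : a *: coker_of x = coker_of (a *: x).
  exact: coker_scaleE.
exact: coker_ofD.
Qed.

Definition coker_proj : {linear V -> coker} := linear_of coker_of_linear.

Lemma coker_surj : surj coker_proj.
Proof. by move=> x; exists (repr x); apply: coker_reprK. Qed.

Lemma coker_exact : exact_at i coker_proj.
Proof.
move=> y; rewrite -(linear0 coker_proj); split=> [/coker_ofP|] [a ia].
  by exists a; rewrite ia subr0.
by apply/coker_ofP; exists a; rewrite ia subr0.
Qed.

End Cokernel.

(** Baer's criterion for E: the relation G is a partial map S -> E defined on
    a left ideal, and the conclusion says that it is induced by
    multiplication with some e. *)
Definition baer (S : pzRingType) (E : lmodType S) : Prop :=
  forall G : S^o -> E -> Prop, linear_rel G -> functional_rel G ->
    exists e, forall r u, G r u -> u = (r : S) *: e.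

(** Zorn's lemma gives a maximal functional linear relation A containing G.
    If v were not in its domain, the criterion applied to
    {(r, u) | A (r v) u} would give an e such that (v, e) can be adjoined
    to A. *)
Lemma baer_extend (S : pzRingType) (E V : lmodType S) (G : V -> E -> Prop) :
  baer E -> linear_rel G -> functional_rel G ->
  exists h : {linear V -> E}, forall x u, G x u -> u = h x.
Proof.
move=> bE Glin Gfun.
pose rel_of (A : set (V * E)) := fun x u => A (x, u).
pose good (A : set (V * E)) :=
  [/\ linear_rel (rel_of A), functional_rel (rel_of A)
    & forall x u, G x u -> A (x, u)].
pose P (A : set (V * E)) := A = set0 \/ good A.
(* The empty set is admitted in P so that empty chains have a union in P. *)
have chainP (F : set (set (V * E))) : (F `<=` P)%classic ->
    total_on F subset -> P (\bigcup_(X in F) X)%classic.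
  move=> FP Ftot.
  have [[X0 FX0 gX0]|nogood] := pselect (exists2 X, F X & good X); last first.
    left; rewrite -subset0 => -[x u] [X FX Xxu].
    have [X0|gX] := FP X FX; first by rewrite X0 in Xxu.
    by case: nogood; exists X.
  right; split.
  - split; first by exists X0 => //; case: gX0 => -[].
    move=> a x y u v [X FX Xxu] [Y FY Yyv].
    wlog XY : x y u v a X Y FX FY Xxu Yyv / (X `<=` Y)%classic => [wl|].
      have [XY|YX] := Ftot X Y FX FY; first exact: (wl x y u v a X Y).
      exists X => //; have [X00|[[_ +] _ _]] := FP X FX.
        by rewrite X00 in Xxu.
      by apply=> //; apply: YX.
    exists Y => //; have [Y00|[[_ +] _ _]] := FP Y FY.
      by rewrite Y00 in Yyv.
    by apply=> //; apply: XY.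
  - move=> u [X FX X0u]; have [X00|[_ + _]] := FP X FX.
      by rewrite X00 in X0u.
    exact.
  - by move=> x u Gxu; exists X0 => //; case: gX0 => _ _; apply.
have [A [PA Amax]] := Zorn_bigcup chainP.
have gA : good A.
  case: PA => // A0; case: (Amax [set p | G p.1 p.2]%classic).
    rewrite A0; split=> // /(_ (0, 0)) /=; apply.
    by case: Glin.
  by right; split.
have [Alin Afun GA] := gA.
have Atot v : exists u, rel_of A v u.
  have [||e Ae] := bE (fun r u => A ((r : S) *: v, u)).
  - split=> [|a r s u w Ar As]; first by rewrite scale0r; case: Alin.
    rewrite scalerDl -[(a *: r : S) *: v]scalerA.
    by case: Alin => _; apply.
  - by move=> u; rewrite scale0r; apply: Afun.
  apply: contrapT => noA.
  pose B := [set p | exists x u (r : S),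
     [/\ A (x, u), p.1 = x + r *: v & p.2 = u + r *: e]]%classic.
  apply: (Amax B).
    split=> [|BA]; last first.
      apply: noA; exists e; apply: BA; exists 0, 0, 1.
      by rewrite !add0r !scale1r; split=> //; case: Alin.
    by move=> [x u] Axu; exists x, u, 0; rewrite !scale0r !addr0.
  right; split; last 1 first.
  - by move=> x u /GA Axu; exists x, u, 0; rewrite !scale0r !addr0.
  - split.
      exists 0, 0, 0; rewrite !scale0r !addr0.
      by split=> //; case: Alin.
    move=> a _ _ _ _ [x [u [r [Axu /= -> ->]]]] [y [w [s [Ayw /= -> ->]]]].
    exists (a *: x + y), (a *: u + w), (a * r + s).
    split=> /=; first by case: Alin => _; apply.
      by rewrite scalerDr scalerDl scalerA addrACA.
    by rewrite scalerDr scalerDl scalerA addrACA.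
  - move=> w [x [u [r [Axu /= /esym/eqP xv ->]]]].
    move: xv; rewrite addr_eq0 => /eqP xv.
    have /Ae -> : A ((- r) *: v, u) by rewrite scaleNr -xv.
    by rewrite scaleNr addNr.
have [h Ah] := linear_of_rel Alin Afun Atot.
exists h => x u /GA Axu; exact: functional_rel_uniq Axu (Ah x).
Qed.

Lemma baer_injective (S : pzRingType) (E : lmodType S) :
  baer E -> injective_module E.
Proof.
move=> bE A B i f i_inj.
pose G (b : B) (u : E) := exists a, b = i a /\ u = f a.
have Glin : linear_rel G.
  split=> [|a _ _ _ _ [x [-> ->]] [y [-> ->]]].
    by exists 0; rewrite !linear0.
  by exists (a *: x + y); rewrite !linearP.
have [u [a [ia ->]]|h Gh] := baer_extend bE Glin.
  by have -> : a = 0 by [apply: i_inj; rewrite linear0]; rewrite linear0.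
by exists h => x; rewrite -(Gh _ (f x)) //; exists x.
Qed.

(** * Tensor products *)
Section TensorTheory.
Variable R : pzRingType.
Implicit Types (A B C : rmodType R) (L M N : lmodType R).

Definition tens A M (a : A) (m : M) : tensor A M := tensor_of [:: (a, m)].

Lemma tensor_of_cat A M (s t : seq (A * M)) :
  tensor_of (s ++ t) = tensor_of s + tensor_of t.
Proof. by symmetry; apply: tensor_addE. Qed.

Lemma tensor_ofE A M (s : seq (A * M)) :
  tensor_of s = \sum_(p <- s) tens p.1 p.2.
Proof.
elim: s => [|[a m] s IHs]; first by rewrite big_nil.
by rewrite big_cons -IHs -tensor_of_cat.
Qed.

Lemma tensDl A M (a b : A) (m : M) : tens (a + b) m = tens a m + tens b m.
Proof. rewrite -tensor_of_cat; exact/tensor_ofP/TensorAddl. Qed.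

Lemma tensDr A M (a : A) (m n : M) : tens a (m + n) = tens a m + tens a n.
Proof. rewrite -tensor_of_cat; exact/tensor_ofP/TensorAddr. Qed.

Lemma tensZ A M (a : A) (r : R) (m : M) :
  tens ((r : R^c) *: a) m = tens a (r *: m).
Proof. exact/tensor_ofP/TensorBal. Qed.

Lemma tens0l A M (m : M) : tens (0 : A) m = 0.
Proof. by apply: (addIr (tens 0 m)); rewrite -tensDl !add0r. Qed.

Lemma tens0r A M (a : A) : tens a (0 : M) = 0.
Proof. by apply: (addIr (tens a 0)); rewrite -tensDr !add0r. Qed.

Lemma tensNl A M (a : A) (m : M) : tens (- a) m = - tens a m.
Proof. by apply: (addIr (tens a m)); rewrite -tensDl !addNr tens0l. Qed.

Lemma tensNr A M (a : A) (m : M) : tens a (- m) = - tens a m.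
Proof. by apply: (addIr (tens a m)); rewrite -tensDr !addNr tens0r. Qed.

Lemma tensBl A M (a b : A) (m : M) : tens (a - b) m = tens a m - tens b m.
Proof. by rewrite tensDl tensNl. Qed.

Lemma tensBr A M (a : A) (m n : M) : tens a (m - n) = tens a m - tens a n.
Proof. by rewrite tensDr tensNr. Qed.

Lemma tens_suml A M I (s : seq I) (F : I -> A) (m : M) :
  tens (\sum_(i <- s) F i) m = \sum_(i <- s) tens (F i) m.
Proof.
elim: s => [|i s IHs]; first by rewrite !big_nil tens0l.
by rewrite !big_cons tensDl IHs.
Qed.

Lemma tens_sumr A M I (s : seq I) (F : I -> M) (a : A) :
  tens a (\sum_(i <- s) F i) = \sum_(i <- s) tens a (F i).
Proof.
elim: s => [|i s IHs]; first by rewrite !big_nil tens0r.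
by rewrite !big_cons tensDr IHs.
Qed.

Lemma tensor_elim A M (P : tensor A M -> Prop) :
  P 0 -> (forall a m x, P x -> P (tens a m + x)) -> forall x, P x.
Proof.
move=> P0 PD x; rewrite -(tensor_reprK x) tensor_ofE.
elim: (repr x) => [|p s IHs]; first by rewrite big_nil.
by rewrite big_cons; apply: PD.
Qed.

(** The universal property of the tensor product with values in a quotient
    G / E, stated without forming the quotient.  It yields both the universal
    property proper (E = 0) and right exactness (E an image). *)
Lemma tensor_lift_mod A M (G : zmodType) (E : G -> Prop) (b : A -> M -> G)
    (s t : seq (A * M)) :
    E 0 -> (forall x y, E x -> E y -> E (x - y)) ->
    (forall a a' m, E (b (a + a') m - (b a m + b a' m))) ->
    (forall a m m', E (b a (m + m') - (b a m + b a m'))) ->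
    (forall a (r : R) m, E (b ((r : R^c) *: a) m - b a (r *: m))) ->
  tensor_of s = tensor_of t ->
  E (\sum_(p <- s) b p.1 p.2 - \sum_(p <- t) b p.1 p.2).
Proof.
move=> E0 EB bDl bDr bZ /tensor_ofP.
have EN x : E x -> E (- x) by rewrite -sub0r; apply: EB.
have ED x y : E x -> E y -> E (x + y).
  by move=> Ex Ey; rewrite -[y]opprK; apply: EB => //; apply: EN.
elim=> {s t} [s|s t _|s t u _ Est _ Etu|s s' t t' _ Es _ Et|s t|m|a a' m|a m m'
  |a r m].
- by rewrite subrr.
- by move=> /EN; rewrite opprB.
- have := ED _ _ Est Etu; by rewrite addrA subrK.
- by rewrite !big_cat /= opprD addrACA; apply: ED.
- by rewrite !big_cat /= [X in _ - X]addrC subrr.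
- rewrite big_seq1 big_nil subr0 /=.
  have := EN _ (bDl 0 0 m); rewrite addr0 opprB. by rewrite addrK.
- rewrite !(big_cons, big_nil) !addr0; exact: bDl.
- rewrite !(big_cons, big_nil) !addr0; exact: bDr.
- rewrite !big_seq1; exact: bZ.
Qed.

Lemma tensor_lift A M (G : zmodType) (b : A -> M -> G) :
    (forall a a' m, b (a + a') m = b a m + b a' m) ->
    (forall a m m', b a (m + m') = b a m + b a m') ->
    (forall a (r : R) m, b ((r : R^c) *: a) m = b a (r *: m)) ->
  exists h : {additive tensor A M -> G}, forall a m, h (tens a m) = b a m.
Proof.
move=> bDl bDr bZ.
pose h (x : tensor A M) : G := \sum_(p <- repr x) b p.1 p.2.
have hE s : h (tensor_of s) = \sum_(p <- s) b p.1 p.2.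
  apply/eqP; rewrite -subr_eq0; apply/eqP.
  apply: (tensor_lift_mod (E := fun x => x = 0)) => //.
  - by move=> ? ? -> ->; rewrite subr0.
  - by move=> *; rewrite bDl subrr.
  - by move=> *; rewrite bDr subrr.
  - by move=> *; rewrite bZ subrr.
  - exact: tensor_reprK.
have hD : {morph h : x y / x + y}.
  move=> x y; rewrite -(tensor_reprK x) -(tensor_reprK y) -tensor_of_cat.
  by rewrite !hE big_cat.
have hB : zmod_morphism h.
  move=> x y; rewrite -[in RHS](subrK y x) (hD (x - y)) addrK //.
exists (additive_of hB) => a m.
by rewrite /= [LHS]hE big_seq1.
Qed.

Section Map.
Variables (A B : rmodType R) (M N : lmodType R).
Variables (f : {linear A -> B}) (g : {linear M -> N}).

Lemma tensor_map_of s :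
  tensor_map f g (tensor_of s) = tensor_of [seq (f p.1, g p.2) | p <- s].
Proof.
apply/tensor_ofP; move: (repr (tensor_of s)) (tensor_repr_of s) => s0.
elim=> {s s0} [s|s t _|s t u _ Est _ Etu|s s' t t' _ Es _ Et|s t|m|a a' m|a m m'
  |a r m] /=.
- exact: TensorRefl.
- exact: TensorSym.
- exact: TensorTrans Est Etu.
- by rewrite !map_cat; apply: TensorCat.
- by rewrite !map_cat; apply: TensorComm.
- by rewrite linear0; apply: TensorZero.
- by rewrite linearD; apply: TensorAddl.
- by rewrite linearD; apply: TensorAddr.
- by rewrite !linearZ; apply: TensorBal.
Qed.

Lemma tensor_map_tens a m : tensor_map f g (tens a m) = tens (f a) (g m).
Proof. exact: tensor_map_of. Qed.

Lemma tensor_map_is_additive : zmod_morphism (tensor_map f g).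
Proof.
have hD : {morph tensor_map f g : x y / x + y}.
  move=> x y; rewrite -(tensor_reprK x) -(tensor_reprK y) -tensor_of_cat.
  by rewrite !tensor_map_of map_cat tensor_of_cat.
by move=> x y; rewrite -[in RHS](subrK y x) (hD (x - y)) addrK.
Qed.

HB.instance Definition _ := GRing.isZmodMorphism.Build (tensor A M) (tensor B N)
  (tensor_map f g) tensor_map_is_additive.

End Map.

Lemma tensor_map_square A B B' C L M M' N
    (f : {linear A -> B}) (f' : {linear B -> C})
    (h : {linear A -> B'}) (h' : {linear B' -> C})
    (g : {linear L -> M}) (g' : {linear M -> N})
    (k : {linear L -> M'}) (k' : {linear M' -> N}) :
    (forall a, f' (f a) = h' (h a)) -> (forall m, g' (g m) = k' (k m)) ->
  forall x, tensor_map f' g' (tensor_map f g x) =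
            tensor_map h' k' (tensor_map h k x).
Proof.
move=> fh gk; elim/tensor_elim => [|a m x IHx]; first by rewrite !raddf0.
by rewrite !raddfD /= IHx !tensor_map_tens fh gk.
Qed.

Lemma tensor_map_comp A B C L M N
    (f : {linear A -> B}) (f' : {linear B -> C}) (h : {linear A -> C})
    (g : {linear L -> M}) (g' : {linear M -> N}) (k : {linear L -> N}) :
    (forall a, f' (f a) = h a) -> (forall m, g' (g m) = k m) ->
  forall x, tensor_map f' g' (tensor_map f g x) = tensor_map h k x.
Proof.
move=> fh gk; elim/tensor_elim => [|a m x IHx]; first by rewrite !raddf0.
by rewrite !raddfD /= IHx !tensor_map_tens fh gk.
Qed.

Lemma tensor_map_eq0 A B M N (f : {linear A -> B}) (g : {linear M -> N}) :
  (forall a, f a = 0) \/ (forall m, g m = 0) -> forall x, tensor_map f g x = 0.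
Proof.
move=> fg; elim/tensor_elim => [|a m x IHx]; first by rewrite raddf0.
rewrite raddfD /= IHx tensor_map_tens addr0.
by case: fg => ->; rewrite (tens0l, tens0r).
Qed.

Lemma tensor_map_surj A B M N (f : {linear A -> B}) (g : {linear M -> N}) :
  surj f -> surj g -> surj (tensor_map f g).
Proof.
move=> fs gs; elim/tensor_elim => [|b n y [x <-]].
  by exists 0; rewrite raddf0.
have [[a <-] [m <-]] := (fs b, gs n).
by exists (tens a m + x); rewrite raddfD /= tensor_map_tens.
Qed.

End TensorTheory.

Notation tmapl M f := (tensor_map f (idfun : {linear M -> M})).
Notation tmapr A g := (tensor_map (idfun : {linear A -> A}) g).

Lemma idfun_surj (T : Type) : surj (@idfun T).
Proof. by move=> x; exists x. Qed.

Lemma injective_ker (U V : zmodType) (f : {additive U -> V}) :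
  (forall x, f x = 0 -> x = 0) -> injective f.
Proof. exact: raddf_inj. Qed.

Lemma ker_injective (U V : zmodType) (f : {additive U -> V}) x :
  injective f -> f x = 0 -> x = 0.
Proof. by move=> fi fx; apply: fi; rewrite raddf0. Qed.

Section RightExact.
Variable R : pzRingType.

(** An inverse (A (x) M) / Im (A (x) f) <- A (x) N is given by
    a (x) n |-> a (x) m for any m with g m = n; it is well defined modulo the
    image because g is exact at M. *)
Lemma tmapr_exact (A : rmodType R) (L M N : lmodType R)
    (f : {linear L -> M}) (g : {linear M -> N}) :
  exact_at f g -> surj g -> exact_at (tmapr A f) (tmapr A g).
Proof.
move=> fg gs y; split=> [|[x <-]]; last first.
  elim/tensor_elim: x => [|a l x IHx]; first by rewrite !raddf0.
  rewrite !raddfD /= IHx !tensor_map_tens addr0.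
  by have -> : g (f l) = 0 by [apply/fg; exists l]; rewrite tens0r.
have [sg sgK] := choice gs.
pose E (z : tensor A M) := exists x, tmapr A f x = z.
have EB z z' : E z -> E z' -> E (z - z').
  by move=> [x <-] [x' <-]; exists (x - x'); rewrite raddfB.
have E0 : E 0 by exists 0; rewrite raddf0.
have E_ker a m : g m = 0 -> E (tens a m).
  by move=> /fg[l <-]; exists (tens a l); rewrite tensor_map_tens.
rewrite -(tensor_reprK y) tensor_map_of.
move=> /(tensor_lift_mod (t := [::]) (E := E) (b := fun a n => tens a (sg n))).
rewrite big_nil subr0 big_map => Ey.
have {}Ey : E (\sum_(p <- repr y) tens p.1 (sg (g p.2))).
  apply: Ey => //.
  - by move=> a a' n; rewrite tensDl subrr.
  - move=> a n n'; rewrite -tensDr -tensBr; apply: E_ker.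
    by rewrite linearB linearD /= !sgK subrr.
  - move=> a r n; rewrite tensZ -tensBr; apply: E_ker.
    by rewrite linearB linearZ /= !sgK subrr.
suff E_diff : E (tensor_of (repr y) - \sum_(p <- repr y) tens p.1 (sg (g p.2))).
  have EN := EB _ _ E0 Ey; rewrite sub0r in EN.
  by have := EB _ _ E_diff EN; rewrite opprK subrK.
rewrite tensor_ofE -sumrB; elim: (repr y) => [|p s IHs].
  by rewrite big_nil.
have EN := EB _ _ E0 IHs; rewrite sub0r in EN.
rewrite big_cons -[X in _ + X]opprK; apply: EB => //.
by rewrite -tensBr; apply: E_ker; rewrite linearB /= sgK subrr.
Qed.

(** The mirror image of [tmapr_exact]. *)
Lemma tmapl_exact (M : lmodType R) (A B C : rmodType R)
    (f : {linear A -> B}) (g : {linear B -> C}) :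
  exact_at f g -> surj g -> exact_at (tmapl M f) (tmapl M g).
Proof.
move=> fg gs y; split=> [|[x <-]]; last first.
  elim/tensor_elim: x => [|a l x IHx]; first by rewrite !raddf0.
  rewrite !raddfD /= IHx !tensor_map_tens addr0.
  by have -> : g (f a) = 0 by [apply/fg; exists a]; rewrite tens0l.
have [sg sgK] := choice gs.
pose E (z : tensor B M) := exists x, tmapl M f x = z.
have EB z z' : E z -> E z' -> E (z - z').
  by move=> [x <-] [x' <-]; exists (x - x'); rewrite raddfB.
have E0 : E 0 by exists 0; rewrite raddf0.
have E_ker b m : g b = 0 -> E (tens b m).
  by move=> /fg[a <-]; exists (tens a m); rewrite tensor_map_tens.
rewrite -(tensor_reprK y) tensor_map_of.
move=> /(tensor_lift_mod (t := [::]) (E := E) (b := fun c m => tens (sg c) m)).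
rewrite big_nil subr0 big_map => Ey.
have {}Ey : E (\sum_(p <- repr y) tens (sg (g p.1)) p.2).
  apply: Ey => //.
  - move=> c c' m; rewrite -tensDl -tensBl; apply: E_ker.
    by rewrite linearB linearD /= !sgK subrr.
  - by move=> c m m'; rewrite tensDr subrr.
  - move=> c r m; rewrite -tensZ -tensBl; apply: E_ker.
    by rewrite linearB linearZ /= !sgK subrr.
suff E_diff : E (tensor_of (repr y) - \sum_(p <- repr y) tens (sg (g p.1)) p.2).
  have EN := EB _ _ E0 Ey; rewrite sub0r in EN.
  by have := EB _ _ E_diff EN; rewrite opprK subrK.
rewrite tensor_ofE -sumrB; elim: (repr y) => [|p s IHs].
  by rewrite big_nil.
have EN := EB _ _ E0 IHs; rewrite sub0r in EN.
rewrite big_cons -[X in _ + X]opprK; apply: EB => //.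
by rewrite -tensBl; apply: E_ker; rewrite linearB /= sgK subrr.
Qed.

End RightExact.

(** * The injective cogenerator Q/Z of abelian groups *)
(** The inclusion of Z in Q, whose cokernel is Q/Z. *)
Lemma int_in_rat_linear : linear (fun n : int^o => n%:~R : zmodule rat).
Proof.
move=> a m n; rewrite scalezrE intrD; congr (_ + _).
by rewrite -[RHS](mulrzr (m%:~R : rat) a) -intrM mulrC.
Qed.

Definition QZ : lmodType int := coker (linear_of int_in_rat_linear).

Lemma QZ_divisible (k : int) (u : QZ) : k != 0 -> exists v : QZ, k *: v = u.
Proof.
move=> k0; have [q <-] := coker_surj u.
exists (coker_proj _ ((q : rat) / k%:~R : zmodule rat)).
rewrite -linearZ /= scalezrE; congr (coker_proj _ _).
by rewrite -mulrzr divfK ?intr_eq0.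
Qed.

(** Subgroups of Z are generated by their least positive element, if any, by
    Euclidean division. *)
Lemma int_subgroup (P : int -> Prop) :
  P 0 -> (forall m n, P m -> P n -> P (m - n)) ->
  exists k : int, P k /\ forall n, P n -> exists q, n = q * k.
Proof.
move=> P0 PB.
have PN m : P m -> P (- m) by rewrite -sub0r; apply: PB.
have PD m n : P m -> P n -> P (m + n).
  by move=> Pm Pn; rewrite -[n]opprK; apply: PB => //; apply: PN.
have PM m (q : int) : P m -> P (q * m).
  have Pnat (n : nat) : P m -> P (n%:Z * m).
    move=> Pm; elim: n => [|n IHn]; first by rewrite mul0r.
    by rewrite intS mulrDl mul1r; apply: PD.
  case: q => n Pm; first exact: Pnat.
  by rewrite NegzE mulNr; apply: PN; apply: Pnat.
have [[m Pm m0]|P_0] := pselect (exists2 m, P m & m != 0); last first.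
  exists 0; split=> // n Pn; exists 0; rewrite mulr0.
  by apply: contrapT => /eqP n0; case: P_0; exists n.
pose p (n : nat) := (0 < n)%N && `[< P n%:Z >].
have exp : exists n, p n.
  exists `|m|%N; rewrite /p absz_gt0 m0; apply/asboolP.
  by rewrite abszE; case: (ger0P m) => _ //; apply: PN.
case: (ex_minnP exp) => k /andP[k0 /asboolP Pk] kmin.
exists k%:Z; split=> // n Pn; exists (n %/ k%:Z)%Z.
have kz0 : k%:Z != 0 by rewrite eqz_nat -lt0n.
have Pr : P (n %% k%:Z)%Z by rewrite /modz; apply: PB => //; apply: PM.
rewrite [LHS](divz_eq n k) -[RHS]addr0; congr (_ + _).
have := modz_ge0 n kz0; have := ltz_pmod n (d := k%:Z) k0.
case: (n %% k%:Z)%Z Pr => // r Pr rk _.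
case: (posnP r) => [-> //|r0].
have : p r by rewrite /p r0; apply/asboolP.
move=> /kmin; rewrite leqNgt -ltz_nat rk //.
Qed.

(** The domain of a partial map Z -> Q/Z is kZ for some k, and the image of k
    can be divided by k. *)
Lemma QZ_baer : baer QZ.
Proof.
move=> G Glin Gfun.
have [||k [[u0 Gk] kP]] := @int_subgroup (fun n => exists u, G n u).
- by exists 0; case: Glin.
- move=> m n [u Gm] [v Gn]; exists (u - v).
  exact: (linear_rel_sub Glin Gm Gn).
have [v kv] : exists v : QZ, k *: v = u0.
  have [k0|/QZ_divisible//] := eqVneq k 0.
  by exists 0; rewrite scaler0; apply/esym/Gfun; rewrite -k0.
exists v => n u Gn; have [q nq] := kP n (ex_intro _ u Gn).
rewrite nq in Gn *; rewrite -scalerA kv.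
exact: (functional_rel_uniq Glin Gfun Gn (linear_relZ Glin q Gk)).
Qed.

Section Characters.
Variable V : zmodType.

Lemma character_extend (G : V -> QZ -> Prop) :
    G 0 0 -> (forall x y u v, G x u -> G y v -> G (x - y) (u - v)) ->
    functional_rel G ->
  exists h : {additive V -> QZ}, forall x u, G x u -> u = h x.
Proof.
move=> G0 GB Gfun.
have GN x u : G x u -> G (- x) (- u).
  by rewrite -(sub0r x) -(sub0r u); apply: GB.
have GD x y u v : G x u -> G y v -> G (x + y) (u + v).
  by move=> Gx Gy; rewrite -[y]opprK -[v]opprK; apply: GB => //; apply: GN.
have GZ (a : int) x u : G x u -> G (x *~ a) (u *~ a).
  move=> Gx; have Gnat (n : nat) : G (x *+ n) (u *+ n).
    by elim: n => // n IHn; rewrite !mulrS; apply: GD.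
  case: a => n; first exact: Gnat.
  by rewrite NegzE !mulrNz; apply: GN; apply: Gnat.
have Glin : @linear_rel int (zmodule V) QZ G.
  split=> // a x y u v Gx Gy; apply: GD => //.
  by rewrite -[a in X in G _ X]intz scaler_int; apply: GZ.
have [h hP] := baer_extend QZ_baer Glin Gfun.
have hB : zmod_morphism (h : V -> QZ) by move=> x y; rewrite -raddfB.
by exists (additive_of hB).
Qed.

(** On the subgroup generated by x, of order k, send x to 1/k, or to 1/2 if
    the order is infinite; then extend to all of V. *)
Lemma character_sep (x : V) : x <> 0 -> exists h : {additive V -> QZ}, h x <> 0.
Proof.
move=> x0.
have [||k [xk kP]] := @int_subgroup (fun n => x *~ n = 0) => //.
  by move=> m n; rewrite mulrzBr => -> ->; rewrite subrr.
(* The annihilator of x is kZ, and k = 0 if x has infinite order. *)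
pose q : rat := if k == 0 then 2^-1 else (k%:~R)^-1.
pose G (y : V) (u : QZ) := exists n : int, y = x *~ n /\
  u = coker_proj (linear_of int_in_rat_linear) (q *~ n : zmodule rat).
have [|||h hP] := @character_extend G.
- by exists 0; rewrite !mulr0z linear0.
- move=> _ _ _ _ [m [-> ->]] [n [-> ->]]; exists (m - n).
  by rewrite !mulrzBr linearB.
- move=> _ [n [/esym/kP[m ->] ->]].
  apply/coker_exact; rewrite /q; have [->|k0] := eqVneq k 0.
    by exists 0; rewrite mulr0 mulr0z.
  exists m => /=; rewrite -[RHS](mulrzr (k%:~R^-1 : rat) (m * k)).
  by rewrite intrM mulrCA mulVf ?mulr1 // intr_eq0.
exists h => hx.
have : coker_proj (linear_of int_in_rat_linear) (q : zmodule rat) = 0.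
  by rewrite -hx; apply: hP; exists 1.
move=> /coker_exact [m /= mq].
(* If h x = 0 then q is an integer m.  But q = 1 / d with d = 2 or d = k,
   and k is not 1 or -1 because x is not 0. *)
have {mq} [d d1 md] : exists2 d : int, `|d|%N <> 1%N & m * d = 1.
  move: mq; rewrite /q; have [_ mq|k0 mq] := eqVneq k 0.
    exists 2 => //; apply/eqP; rewrite -(eqr_int rat) intrM mq.
    by rewrite mulVf.
  exists k; last first.
    by apply/eqP; rewrite -(eqr_int rat) intrM mq mulVf ?intr_eq0.
  have kpm : `|k|%N = 1%N -> k = 1 \/ k = -1.
    by case: (k) => [[|[|n]]|[|n]] //= _; [left | right].
  move=> /kpm k1; apply: x0; move: xk; case: k1 => ->; first by rewrite mulr1z.
  by rewrite mulrN1z => /eqP; rewrite oppr_eq0 => /eqP.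
have /eqP := congr1 absz md; rewrite abszM muln_eq1 => /andP[_ /eqP].
exact: d1.
Qed.

End Characters.

(** * Free covers and dual bases *)
Lemma sum_supp (X : eqType) (V : zmodType) (F : X -> V) (s t : seq X) :
    uniq s -> uniq t -> (forall x, x \notin s -> F x = 0) ->
    (forall x, x \notin t -> F x = 0) ->
  \sum_(x <- s) F x = \sum_(x <- t) F x.
Proof.
have main (r : seq X) :
    \sum_(x <- r) F x = \sum_(x <- [seq x <- r | F x != 0]) F x.
  by rewrite big_filter [RHS]big_mkcond; apply: eq_bigr => x _; case: eqP.
move=> us ut Fs Ft; rewrite (main s) (main t); apply: perm_big.
apply: uniq_perm; rewrite ?filter_uniq // => x; rewrite !mem_filter.
have [//|/= Fx] := eqVneq (F x) 0.
have -> : x \in s by apply: contraT => /Fs/eqP; rewrite (negPf Fx).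
by apply/esym; apply: contraT => /Ft/eqP; rewrite (negPf Fx).
Qed.

Definition supported (X : eqType) (V : zmodType) (F : X -> V) (s : seq X) :=
  uniq s /\ forall x, x \notin s -> F x = 0.

Lemma supported_sub (X : eqType) (V : zmodType) (F : X -> V) (s t : seq X) :
  uniq t -> {subset s <= t} -> supported F s -> supported F t.
Proof. by move=> ut st [us Fs]; split=> // x xt; apply/Fs/(contra (st x)). Qed.

(** A dual basis (e, c) writes each u as the sum of the c x u *: e x, almost
    all of whose terms vanish.  Having one characterizes projective modules;
    it is the only feature of free modules that is needed for flatness. *)
Definition dual_basis (S : pzRingType) (F : lmodType S) (X : eqType)
    (e : X -> F) (c : X -> F -> S) : Prop :=
  (forall x a u v, c x (a *: u + v) = a * c x u + c x v) /\
  forall u, exists s, supported (c^~ u) s /\ u = \sum_(x <- s) c x u *: e x.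

Section DualBasisTheory.
Variables (S : pzRingType) (F : lmodType S) (X : eqType).
Variables (e : X -> F) (c : X -> F -> S).
Hypothesis ec : dual_basis e c.

Lemma dual_coordD x u v : c x (u + v) = c x u + c x v.
Proof. by case: ec => /(_ x 1 u v); rewrite scale1r mul1r. Qed.

Lemma dual_coord0 x : c x 0 = 0.
Proof. by apply: (addIr (c x 0)); rewrite -dual_coordD !add0r. Qed.

Lemma dual_coordZ x a u : c x (a *: u) = a * c x u.
Proof. by case: ec => /(_ x a u 0); rewrite !addr0 dual_coord0 addr0. Qed.

End DualBasisTheory.

Section TensorDualBasis.
Variable R : pzRingType.

(** The coordinates c x induce coordinate maps Q (x) M -> M which detect
    zero and commute with Q (x) f. *)
Lemma dual_basis_rflat (Q : rmodType R) (X : eqType) (e : X -> Q)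
    (c : X -> Q -> R^c) (M N : lmodType R) (f : {linear M -> N}) :
  dual_basis e c -> injective f -> injective (tmapr Q f).
Proof.
move=> ec f_inj.
have coord (L : lmodType R) : exists k : X -> {additive tensor Q L -> L},
    forall x q l, k x (tens q l) = (c x q : R) *: l.
  suff /choice[k kP] : forall x, exists h : {additive tensor Q L -> L},
      forall q l, h (tens q l) = (c x q : R) *: l by exists k.
  move=> x.
  apply: (tensor_lift (b := fun q l => (c x q : R) *: l)).
  - by move=> q q' l; rewrite (dual_coordD ec) scalerDl.
  - by move=> q l l'; rewrite scalerDr.
  - by move=> q r l; rewrite (dual_coordZ ec) scalerA.
have [k kE] := coord M; have [k' k'E] := coord N.
have expand (z : tensor Q M) : exists s, supported (k^~ z) s /\
    z = \sum_(x <- s) tens (e x) (k x z).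
  elim/tensor_elim: z => [|q m z [s [[us zs] zE]]].
    by exists [::]; split; [split=> // x _; rewrite raddf0 | rewrite big_nil].
  case: ec => _ /(_ q)[t [[ut qt] qE]].
  pose r := undup (s ++ t); have ur : uniq r by apply: undup_uniq.
  have rs x : x \notin r -> x \notin s.
    by rewrite mem_undup mem_cat negb_or => /andP[].
  have rt x : x \notin r -> x \notin t.
    by rewrite mem_undup mem_cat negb_or => /andP[].
  exists r; split.
    split=> // x xr; rewrite raddfD /= kE zs ?rs // qt ?rt //.
    by rewrite scale0r addr0.
  under eq_bigr => x do rewrite raddfD /= kE tensDr.
  rewrite big_split /=; congr (_ + _).
    rewrite {1}qE tens_suml (sum_supp ut ur).
    - by apply: eq_bigr => x _; rewrite -tensZ.
    - by move=> x /qt ->; rewrite scale0r tens0l.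
    - by move=> x /rt /qt ->; rewrite scale0r tens0l.
  rewrite {1}zE (sum_supp us ur) //.
  - by move=> x /zs ->; rewrite tens0r.
  - by move=> x /rs /zs ->; rewrite tens0r.
have kf x z : k' x (tmapr Q f z) = f (k x z).
  elim/tensor_elim: z => [|q m z IHz]; first by rewrite !raddf0.
  by rewrite !raddfD /= IHz tensor_map_tens kE k'E linearZ.
apply: injective_ker => z fz; have [s [_ ->]] := expand z.
rewrite big1 // => x _; rewrite (_ : k x z = 0) ?tens0r //.
have := kf x z; rewrite fz raddf0 => /esym; exact: ker_injective f_inj.
Qed.

(** The mirror image of [dual_basis_rflat]. *)
Lemma dual_basis_lflat (F : lmodType R) (X : eqType) (e : X -> F)
    (c : X -> F -> R) (A B : rmodType R) (f : {linear A -> B}) :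
  dual_basis e c -> injective f -> injective (tmapl F f).
Proof.
move=> ec f_inj.
have coord (C : rmodType R) : exists k : X -> {additive tensor C F -> C},
    forall x a u, k x (tens a u) = (c x u : R^c) *: a.
  suff /choice[k kP] : forall x, exists h : {additive tensor C F -> C},
      forall a u, h (tens a u) = (c x u : R^c) *: a by exists k.
  move=> x.
  apply: (tensor_lift (b := fun a u => (c x u : R^c) *: a)).
  - by move=> a a' u; rewrite scalerDr.
  - by move=> a u v; rewrite (dual_coordD ec) scalerDl.
  - by move=> a r u; rewrite (dual_coordZ ec) scalerA.
have [k kE] := coord A; have [k' k'E] := coord B.
have expand (z : tensor A F) : exists s, supported (k^~ z) s /\
    z = \sum_(x <- s) tens (k x z) (e x).
  elim/tensor_elim: z => [|a u z [s [[us zs] zE]]].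
    by exists [::]; split; [split=> // x _; rewrite raddf0 | rewrite big_nil].
  case: ec => _ /(_ u)[t [[ut qt] qE]].
  pose r := undup (s ++ t); have ur : uniq r by apply: undup_uniq.
  have rs x : x \notin r -> x \notin s.
    by rewrite mem_undup mem_cat negb_or => /andP[].
  have rt x : x \notin r -> x \notin t.
    by rewrite mem_undup mem_cat negb_or => /andP[].
  exists r; split.
    split=> // x xr; rewrite raddfD /= kE zs ?rs // qt ?rt //.
    by rewrite scale0r addr0.
  under eq_bigr => x do rewrite raddfD /= kE tensDl.
  rewrite big_split /=; congr (_ + _).
    rewrite {1}qE tens_sumr (sum_supp ut ur).
    - by apply: eq_bigr => x _; rewrite -tensZ.
    - by move=> x /qt ->; rewrite scale0r tens0r.
    - by move=> x /rt /qt ->; rewrite scale0r tens0r.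
  rewrite {1}zE (sum_supp us ur) //.
  - by move=> x /zs ->; rewrite tens0l.
  - by move=> x /rs /zs ->; rewrite tens0l.
have kf x z : k' x (tmapl F f z) = f (k x z).
  elim/tensor_elim: z => [|a u z IHz]; first by rewrite !raddf0.
  by rewrite !raddfD /= IHz tensor_map_tens kE k'E linearZ.
apply: injective_ker => z fz; have [s [_ ->]] := expand z.
rewrite big1 // => x _; rewrite (_ : k x z = 0) ?tens0l //.
have := kf x z; rewrite fz raddf0 => /esym; exact: ker_injective f_inj.
Qed.

End TensorDualBasis.

Section FreeCover.
Variables (S : pzRingType) (M : lmodType S).

Definition fin_supp (f : M -> S^o) : Prop := exists s, supported f s.

Lemma fin_supp0 : fin_supp 0.
Proof. by exists [::]; split. Qed.

Lemma common_support (f g : M -> S^o) : fin_supp f -> fin_supp g ->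
  exists s, supported f s /\ supported g s.
Proof.
move=> [s fs] [t gt]; exists (undup (s ++ t)); split.
  apply: supported_sub fs; rewrite ?undup_uniq // => x xs.
  by rewrite mem_undup mem_cat xs.
apply: supported_sub gt; rewrite ?undup_uniq // => x xs.
by rewrite mem_undup mem_cat xs orbT.
Qed.

Lemma fin_suppD (a : S) (f g : M -> S^o) :
  fin_supp f -> fin_supp g -> fin_supp (a *: f + g).
Proof.
move=> ff gg; have [s [[us fs] [_ gs]]] := common_support ff gg.
exists s; split=> // x xs.
have -> : (a *: f + g) x = a *: f x + g x by [].
by rewrite fs // gs // scaler0 addr0.
Qed.

(** The free module on the set M, realized as the functions M -> S of finite
    support, maps onto M. *)
Lemma exists_free_cover : exists (F : lmodType S) (p : {linear F -> M})
    (e : M -> F) (c : M -> F -> S), surj p /\ dual_basis e c.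
Proof.
pose J := prop_submod fin_supp0 fin_suppD.
pose F : lmodType S := submodule J.
pose c (x : M) (u : F) : S := (val u) x.
have cZ x a u v : c x (a *: u + v) = a * c x u + c x v by rewrite /c linearP.
have cF u : exists s, supported (c^~ u) s.
  by have /prop_submodE := valP u.
pose d (x y : M) : S^o := if y == x then 1 else 0.
have dJ x : d x \in J.
  apply/prop_submodE; exists [:: x]; split=> // y.
  by rewrite inE /d => /negPf ->.
pose e x : F := exist _ (d x) (dJ x).
have ec : dual_basis e c.
  split=> // u; have [s us] := cF u; exists s; split=> //.
  apply: val_inj; apply/funext => y; rewrite raddf_sum fct_sumE /=.
  have du0 x : x != y -> (c x u *: d x) y = 0.
    move=> xy; have -> : (c x u *: d x) y = c x u *: d x y by [].
    by rewrite /d eq_sym (negPf xy) scaler0.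
  rewrite (@sum_supp _ S^o (fun x => (c x u *: d x) y) s [:: y]) //.
  - have -> : forall F : M -> S^o, \sum_(x <- [:: y]) F x = F y.
      by move=> F'; rewrite big_seq1.
    by rewrite -[RHS]/(c y u *: d y y) /d eqxx -[RHS]/(c y u * 1) mulr1.
  - by case: us.
  - by case: us => _ us x /us cx; rewrite -[LHS]/(c x u *: d x y) cx scale0r.
  - by move=> x; rewrite inE => /du0.
pose G (u : F) (m : M) := exists s, supported (c^~ u) s /\
  m = \sum_(x <- s) c x u *: x.
have Glin : linear_rel G.
  split=> [|a u v _ _ [s [us ->]] [t [vt ->]]].
    by exists [::]; split; [split | rewrite big_nil].
  have [r [ur vr]] : exists r, supported (c^~ u) r /\ supported (c^~ v) r.
    by apply: (@common_support (val u) (val v)); [exists s | exists t].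
  exists r; split.
    by split=> [|x xr]; [case: ur | rewrite cZ ur.2 // vr.2 // mulr0 addr0].
  rewrite (sum_supp us.1 ur.1); first last.
  - by move=> x /ur.2 ->; rewrite scale0r.
  - by move=> x /us.2 ->; rewrite scale0r.
  rewrite (sum_supp vt.1 vr.1); first last.
  - by move=> x /vr.2 ->; rewrite scale0r.
  - by move=> x /vt.2 ->; rewrite scale0r.
  rewrite scaler_sumr -big_split /=; apply: eq_bigr => x _.
  by rewrite cZ scalerDl scalerA.
have Gfun : functional_rel G.
  move=> _ [s [_ ->]]; rewrite big1 // => x _.
  by rewrite (dual_coord0 ec) scale0r.
have [u|p Gp] := linear_of_rel Glin Gfun.
  by have [s us] := cF u; exists (\sum_(x <- s) c x u *: x); exists s.
exists F, p, e, c; split=> // x; exists (e x).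
apply: (functional_rel_uniq Glin Gfun (Gp _)); exists [:: x]; split.
  by split=> // y; rewrite inE /c /= /d => /negPf ->.
by rewrite big_seq1 /c /= /d eqxx scale1r.
Qed.

End FreeCover.

(** * Character modules *)
Section CharacterGroup.
Variable V : zmodType.

Definition character_pred : {pred V -> QZ} := fun f => `[< zmod_morphism f >].

Lemma character_pred_closed : zmod_closed character_pred.
Proof.
split=> [|f g /asboolP fB /asboolP gB]; apply/asboolP => x y.
  by rewrite -[LHS]/(0 : QZ) -[RHS]/(0 - 0 : QZ) subr0.
rewrite -[LHS]/(f (x - y) - g (x - y)) -[RHS]/(f x - g x - (f y - g y)).
by rewrite fB gB !opprD !opprK addrACA.
Qed.

HB.instance Definition _ :=
  GRing.isZmodClosed.Build (V -> QZ) character_pred character_pred_closed.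

Definition character : Type := {f : V -> QZ | f \in character_pred}.

HB.instance Definition _ := SubChoice.on character.
HB.instance Definition _ := [SubChoice_isSubZmodule of character by <:].

Definition pairing (f : character) (x : V) : QZ := val f x.

Lemma pairingBr f : zmod_morphism (pairing f).
Proof. exact/asboolP/(valP f). Qed.

HB.instance Definition _ f :=
  GRing.isZmodMorphism.Build V QZ (pairing f) (pairingBr f).

Lemma pairingDl f g x : pairing (f + g) x = pairing f x + pairing g x.
Proof. by []. Qed.

Lemma pairing0l x : pairing 0 x = 0.
Proof. by []. Qed.

Lemma pairing_ext f g : pairing f =1 pairing g -> f = g.
Proof. by move=> fg; apply/val_inj/funext. Qed.

Lemma exists_character (h : V -> QZ) :
  (forall x y, h (x + y) = h x + h y) -> exists f : character, pairing f =1 h.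
Proof.
move=> hD.
have hB : zmod_morphism h.
  by move=> x y; rewrite -[in RHS](subrK y x) (hD (x - y)) addrK.
by exists (exist _ h (asboolT hB)).
Qed.

End CharacterGroup.

Section CharacterModule.
Variables (S T : pzRingType) (phi : T -> S) (V : lmodType S).
Hypotheses (phiD : {morph phi : x y / x + y}) (phi1 : phi 1 = 1)
  (phiM : forall x y, phi (x * y) = phi y * phi x).

Lemma character_scale_subproof (a : T) (f : character V) :
  exists g : character V, forall x, pairing g x = pairing f (phi a *: x).
Proof. by apply: exists_character => x y; rewrite scalerDr raddfD. Qed.

Definition character_scale (a : T) (f : character V) : character V :=
  projT1 (cid (character_scale_subproof a f)).

Lemma character_scaleE a f x :
  pairing (character_scale a f) x = pairing f (phi a *: x).
Proof. by rewrite /character_scale; case: cid. Qed.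

Lemma character_scaleA a b f :
  character_scale a (character_scale b f) = character_scale (a * b) f.
Proof.
by apply: pairing_ext => x; rewrite !character_scaleE phiM scalerA.
Qed.

Lemma character_scale1 : left_id 1 character_scale.
Proof.
by move=> f; apply: pairing_ext => x; rewrite character_scaleE phi1 scale1r.
Qed.

Lemma character_scaleDr : right_distributive character_scale +%R.
Proof.
move=> a f g; apply: pairing_ext => x.
by rewrite pairingDl !character_scaleE pairingDl.
Qed.

Lemma character_scaleDl f : {morph character_scale^~ f : a b / a + b}.
Proof.
move=> a b; apply: pairing_ext => x.
by rewrite pairingDl !character_scaleE phiD scalerDl raddfD.
Qed.

(** The character group of V is a module on the other side.  The map phi, an
    anti-homomorphism of rings, makes one construction serve both left and
    right modules: in the two uses below it is the identity between R and its
    converse ring. *)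
Definition character_module : lmodType T :=
  HB.pack (character V) (GRing.Zmodule_isLmodule.Build T (character V)
    character_scaleA character_scale1 character_scaleDr character_scaleDl).

End CharacterModule.

Section Duals.
Variable R : pzRingType.

Definition ldual (M : lmodType R) : rmodType R :=
  @character_module R R^c id M (fun _ _ => erefl) erefl (fun _ _ => erefl).

Definition rdual (A : rmodType R) : lmodType R :=
  @character_module R^c R id A (fun _ _ => erefl) erefl (fun _ _ => erefl).

Lemma ldualZ (M : lmodType R) (f : ldual M) (r : R) x :
  pairing ((r : R^c) *: f : ldual M) x = pairing f (r *: x).
Proof. exact: character_scaleE. Qed.

Lemma rdualZ (A : rmodType R) (f : rdual A) (r : R) x :
  pairing (r *: f : rdual A) x = pairing f ((r : R^c) *: x).
Proof. exact: character_scaleE. Qed.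

(** This lemma and [ldual_hom] are the two directions of the adjunction
    Hom_R(A, Hom_Z(M, Q/Z)) = Hom_Z(A (x) M, Q/Z); [rdual_lift] and
    [rdual_hom] are those for the other variable. *)
Lemma ldual_lift (A : rmodType R) (M : lmodType R) (f : {linear A -> ldual M}) :
  exists h : {additive tensor A M -> QZ},
    forall a m, h (tens a m) = pairing (f a) m.
Proof.
apply: (tensor_lift (b := fun a m => pairing (f a) m)).
- by move=> a a' m; rewrite linearD pairingDl.
- by move=> a m m'; rewrite raddfD.
- by move=> a r m; rewrite linearZ ldualZ.
Qed.

Lemma ldual_hom (A : rmodType R) (M : lmodType R)
    (h : {additive tensor A M -> QZ}) :
  exists f : {linear A -> ldual M}, forall a m, pairing (f a) m = h (tens a m).
Proof.
have /choice[f fE] : forall a, exists f : ldual M,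
    pairing f =1 (fun m => h (tens a m)).
  by move=> a; apply: exists_character => m m'; rewrite tensDr raddfD.
have flin : linear f.
  move=> r a b; apply: pairing_ext => m.
  by rewrite pairingDl ldualZ !fE tensDl raddfD /= tensZ.
by exists (linear_of flin) => a m; apply: fE.
Qed.

Lemma rdual_lift (A : rmodType R) (M : lmodType R) (f : {linear M -> rdual A}) :
  exists h : {additive tensor A M -> QZ},
    forall a m, h (tens a m) = pairing (f m) a.
Proof.
apply: (tensor_lift (b := fun a m => pairing (f m) a)).
- by move=> a a' m; rewrite raddfD.
- by move=> a m m'; rewrite linearD pairingDl.
- by move=> a r m; rewrite linearZ rdualZ.
Qed.

Lemma rdual_hom (A : rmodType R) (M : lmodType R)
    (h : {additive tensor A M -> QZ}) :
  exists f : {linear M -> rdual A}, forall a m, pairing (f m) a = h (tens a m).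
Proof.
have /choice[f fE] : forall m, exists f : rdual A,
    pairing f =1 (fun a => h (tens a m)).
  by move=> m; apply: exists_character => a a'; rewrite tensDl raddfD.
have flin : linear f.
  move=> r m n; apply: pairing_ext => a.
  by rewrite pairingDl rdualZ !fE tensDr raddfD /= tensZ.
by exists (linear_of flin) => a m; apply: fE.
Qed.

Lemma character_extend_inj (U V : zmodType) (i : {additive U -> V})
    (f : {additive U -> QZ}) : (forall x, i x = 0 -> f x = 0) ->
  exists g : {additive V -> QZ}, forall x, g (i x) = f x.
Proof.
move=> ker_if; pose G y u := exists x, y = i x /\ u = f x.
have [|||g gP] := @character_extend V G.
- by exists 0; rewrite !raddf0.
- by move=> _ _ _ _ [x [-> ->]] [y [-> ->]]; exists (x - y); rewrite !raddfB.
- by move=> _ [x [/esym/ker_if -> ->]].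
by exists g => x; apply/esym/gP; exists x.
Qed.

Lemma ldual_extend (A B : rmodType R) (M : lmodType R) (i : {linear A -> B})
    (f : {linear A -> ldual M}) : injective (tmapl M i) ->
  exists g : {linear B -> ldual M}, forall a, g (i a) = f a.
Proof.
move=> i_inj; have [h hE] := ldual_lift f.
have [|k kE] := @character_extend_inj _ _ (tmapl M i) h.
  by move=> x /(ker_injective i_inj) ->; rewrite raddf0.
have [g gE] := ldual_hom k; exists g => a; apply: pairing_ext => m.
by rewrite gE -hE -kE /= tensor_map_tens.
Qed.

(** By adjunction, the map to extend is a character of A (x) M, and these
    extend to A (x) N as Q/Z is injective. *)
Lemma rdual_extend (A : rmodType R) (M N : lmodType R) (i : {linear M -> N})
    (f : {linear M -> rdual A}) : injective (tmapr A i) ->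
  exists g : {linear N -> rdual A}, forall a, g (i a) = f a.
Proof.
move=> i_inj; have [h hE] := rdual_lift f.
have [|k kE] := @character_extend_inj _ _ (tmapr A i) h.
  by move=> x /(ker_injective i_inj) ->; rewrite raddf0.
have [g gE] := rdual_hom k; exists g => m; apply: pairing_ext => a.
by rewrite gE -hE -kE /= tensor_map_tens.
Qed.

Lemma flatP (M : lmodType R) :
  (forall (A B : rmodType R) (i : {linear A -> B}), injective i ->
     injective (tmapl M i)) -> flat M.
Proof.
move=> Minj A B C f g [fi fg gs]; split; first exact: Minj.
  exact: tmapl_exact.
exact: tensor_map_surj gs (@idfun_surj M).
Qed.

Lemma flat_inj (M : lmodType R) (A B : rmodType R) (i : {linear A -> B}) :
  flat M -> injective i -> injective (tmapl M i).
Proof.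
move=> Mflat i_inj.
by have [] := Mflat _ _ _ i (coker_proj i)
  (And3 i_inj (@coker_exact _ _ _ i) (@coker_surj _ _ _ i)).
Qed.

Lemma flat_ldual_injective (M : lmodType R) :
  flat M -> injective_module (ldual M).
Proof. by move=> Mflat A B i f i_inj; apply: ldual_extend; apply: flat_inj. Qed.

(** Half of Lambek's theorem.  If x in A (x) M dies in B (x) M, a character
    of A (x) M not vanishing at x corresponds to a map A -> M^+; its extension
    to B gives a character of B (x) M whose restriction does not vanish
    at x, a contradiction. *)
Lemma ldual_injective_flat (M : lmodType R) :
  injective_module (ldual M) -> flat M.
Proof.
move=> Minj; apply: flatP => A B i i_inj; apply: injective_ker => x ix.
apply: contrapT => /character_sep[h hx].
have [f fE] := ldual_hom h; have [g gE] := Minj _ _ i f i_inj.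
have [k kE] := ldual_lift g; apply: hx.
suff <- : k (tmapl M i x) = h x by rewrite ix raddf0.
elim/tensor_elim: x {ix} => [|a m x IHx]; first by rewrite !raddf0.
by rewrite !raddfD /= IHx tensor_map_tens kE gE fE.
Qed.

Lemma exists_biduality (M : lmodType R) :
  exists e : {linear M -> rdual (ldual M)},
    forall m f, pairing (e m) f = pairing f m.
Proof.
have /choice[e eE] : forall m : M, exists u : rdual (ldual M),
    forall f : ldual M, pairing u f = pairing f m.
  by move=> m; apply: exists_character.
have elin : linear e.
  move=> r m n; apply: pairing_ext => f.
  by rewrite pairingDl rdualZ !eE ldualZ raddfD.
by exists (linear_of elin).
Qed.

(** A character h of A (x) M, seen as f : A -> M^+, extends to
    A (x) M^++ by a (x) u |-> u (f a).  As characters separate points,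
    A (x) M -> A (x) M^++ has no kernel. *)
Lemma biduality_pure (M : lmodType R) (e : {linear M -> rdual (ldual M)})
    (A : rmodType R) :
  (forall m f, pairing (e m) f = pairing f m) -> injective (tmapr A e).
Proof.
move=> eE; apply: injective_ker => x ex.
apply: contrapT => /character_sep[h hx].
have [f fE] := ldual_hom h.
have [k kE] : exists k : {additive tensor A (rdual (ldual M)) -> QZ},
    forall a u, k (tens a u) = pairing u (f a).
  apply: (tensor_lift (b := fun a (u : rdual (ldual M)) => pairing u (f a))).
  - by move=> a a' u; rewrite linearD raddfD.
  - by [].
  - by move=> a r u; rewrite linearZ rdualZ.
apply: hx; suff <- : k (tmapr A e x) = h x by rewrite ex raddf0.
elim/tensor_elim: x {ex} => [|a m x IHx]; first by rewrite !raddf0.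
by rewrite !raddfD /= IHx tensor_map_tens kE eE fE.
Qed.

Lemma biduality_injective (M : lmodType R) (e : {linear M -> rdual (ldual M)}) :
  (forall m f, pairing (e m) f = pairing f m) -> injective e.
Proof.
move=> eE; apply: injective_ker => m em.
apply: contrapT => /character_sep[h hm].
have [f fE] : exists f : ldual M, pairing f =1 h.
  by apply: exists_character => x y; rewrite raddfD.
by apply: hm; rewrite -fE -eE em.
Qed.

End Duals.

(** * Over a coherent ring, character modules of injectives are flat *)
Lemma linear_rel_sum (S : pzRingType) (V W : lmodType S) (G : V -> W -> Prop)
    I (s : seq I) (a : I -> S) (x : I -> V) (u : I -> W) :
  linear_rel G -> (forall i, G (x i) (u i)) ->
  G (\sum_(i <- s) a i *: x i) (\sum_(i <- s) a i *: u i).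
Proof.
move=> [G0 GD] Gxu; elim: s => [|i s IHs]; first by rewrite !big_nil.
by rewrite !big_cons; apply: GD.
Qed.

(** The converse of [baer_injective]: a partial map out of S is a map on the
    submodule where it is defined. *)
Lemma injective_baer (S : pzRingType) (E : lmodType S) :
  injective_module E -> baer E.
Proof.
move=> Einj G Glin Gfun; pose dom (x : S^o) := exists u, G x u.
have dom0 : dom 0 by exists 0; case: Glin.
have domD a x y : dom x -> dom y -> dom (a *: x + y).
  by move=> [u Gu] [v Gv]; exists (a *: u + v); case: Glin => _; apply.
pose J := prop_submod dom0 domD.
have [||x|f Gf] := @linear_of_rel S (submodule J) E (fun x u => G (val x) u).
- by case: Glin => G0 GD; split=> // a x y u v; apply: GD.
- by move=> u; apply: Gfun.
- exact/(prop_submodE dom0 domD)/valP.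
have [g gE] := Einj _ _ (val : {linear submodule J -> S^o}) f val_inj.
exists (g 1) => r u Gru.
have rJ : (r : S^o) \in J by apply/(prop_submodE dom0 domD); exists u.
have := Gf (exist _ (r : S^o) rJ); rewrite -gE /= => Gr.
rewrite (functional_rel_uniq Glin Gfun Gru Gr) -linearZ /=.
by congr (g _); rewrite -[RHS]/((r : S) * 1) mulr1.
Qed.

(** Over a left coherent ring the relations between finitely many elements r
    are finitely generated.  The ideal they generate has a finite
    presentation on other generators s, with relation matrix Y.  Writing
    s = W r and r = V s, each relation c between the entries of r satisfies
    c = c (1 - V W) + (c V) W, where c V is a relation between the entries
    of s, hence a combination of the rows of Y.  So the rows of 1 - V W and
    of Y W generate the relations. *)
Lemma coherent_relations (S : pzRingType) :
    (forall J : submodClosed S^o, finitely_generated (submodule J) ->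
      finitely_presented (submodule J)) ->
  forall n (r : 'cV[S]_n), exists m (a : 'M[S]_(m, n)), a *m r = 0 /\
    forall c : 'rV[S]_n, c *m r = 0 -> exists b, c = b *m a.
Proof.
move=> coh n r; pose comb (x : S^o) := exists c : 'rV[S]_n, x = (c *m r) 0 0.
have comb0 : comb 0 by exists 0; rewrite mul0mx mxE.
have combD a x y : comb x -> comb y -> comb (a *: x + y).
  move=> [c ->] [d ->]; exists (a *: c + d).
  by rewrite mulmxDl -scalemxAl [RHS]mxE [X in _ = X + _]mxE.
pose J := prop_submod comb0 combD.
have rJ i : (r i 0 : S^o) \in J.
  apply/(prop_submodE comb0 combD); exists (delta_mx 0 i).
  by rewrite -rowE mxE.
pose e i : submodule J := exist _ (r i 0 : S^o) (rJ i).
have [|F1 [F0 [d [p [[m [f1 f1_bij]] [k [f0 f0_bij]] dp p_surj]]]]] := coh J.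
  exists n, e => x; have /prop_submodE[c xc] := valP x.
  exists (fun i => c 0 i); apply: val_inj; rewrite raddf_sum xc mxE /=.
  by apply: eq_bigr.
pose Q (z : 'rV[S]_k) : S^o := val (p (f0 z)).
have Qsum q (c : 'rV[S]_q) (t : 'M[S]_(q, k)) :
    Q (c *m t) = \sum_i c 0 i *: Q (row i t).
  rewrite /Q mulmx_sum_row !linear_sum; apply: eq_bigr => i _.
  by rewrite !linearZ.
have [w wP] : exists w : 'I_k -> 'rV[S]_n,
    forall j, Q (delta_mx 0 j) = (w j *m r) 0 0.
  suff /choice[w wP] : forall j, exists c : 'rV[S]_n,
    Q (delta_mx 0 j) = (c *m r) 0 0 by exists w.
  by move=> j; apply/(prop_submodE comb0 combD)/valP.
pose W := \matrix_j w j.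
have QW z : Q z = (z *m W *m r) 0 0.
  rewrite -[z in Q z]mulmx1 Qsum -mulmxA mxE; apply: eq_bigr => j _.
  rewrite row1 wP; congr (_ * _).
  by rewrite [in RHS]mxE [in LHS]mxE; apply: eq_bigr => i _; rewrite mxE.
have f0_surj z : exists x, f0 x = z by case: f0_bij => g _ gK; exists (g z).
have [v vP] : exists v : 'I_n -> 'rV[S]_k, forall i, Q (v i) = r i 0.
  suff /choice[v vP] : forall i, exists z, Q z = r i 0 by exists v.
  move=> i; have [x px] := p_surj (e i); have [z zx] := f0_surj x.
  by exists z; rewrite /Q zx px.
pose V := \matrix_i v i.
have QV (c : 'rV[S]_n) : Q (c *m V) = (c *m r) 0 0.
  by rewrite Qsum mxE; apply: eq_bigr => i _; rewrite rowK vP.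
have [y yP] : exists y : 'I_m -> 'rV[S]_k,
    forall l, f0 (y l) = d (f1 (delta_mx 0 l)).
  suff /choice[y yP] : forall l, exists z, f0 z = d (f1 (delta_mx 0 l)).
    by exists y.
  by move=> l; apply: f0_surj.
pose Y := \matrix_l y l.
have dY t : d (f1 t) = f0 (t *m Y).
  rewrite -[t in LHS]mulmx1 !mulmx_sum_row !linear_sum; apply: eq_bigr => l _.
  by rewrite !linearZ /= row1 rowK yP.
have entry0 q (A : 'M[S]_(q, n)) :
    (forall c : 'rV[S]_q, (c *m A *m r) 0 0 = 0) -> A *m r = 0.
  move=> A0; apply/matrixP => i j; rewrite [j]ord1 [RHS]mxE.
  by have := A0 (delta_mx 0 i); rewrite -mulmxA -rowE [LHS]mxE.
(* The rows of Y W express the relations between the new generators in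
   the old ones; those of 1 - V W say that translating an old generator
   back and forth changes nothing. *)
exists (m + n)%N, (col_mx (Y *m W) (1%:M - V *m W)); split.
  apply: entry0 => c; rewrite -[c]hsubmxK mul_row_col mulmxDl mxE.
  rewrite !mulmxA -QW; have -> : Q (lsubmx c *m Y) = 0.
    by rewrite /Q -dY; have -> : p (d (f1 (lsubmx c))) = 0 by apply/dp; eexists.
  rewrite add0r mulmxBr mulmx1 mulmxBl mxE -QV [X in _ + X]mxE.
  by rewrite mulmxA -QW subrr.
move=> c cr0; have : p (f0 (c *m V)) = 0.
  by apply: val_inj; rewrite -[LHS]/(Q _) QV cr0 mxE.
move=> /dp[x1 dx1]; case: (f1_bij) => g1 _ g1K.
exists (row_mx (g1 x1) c); rewrite mul_row_col mulmxA.
have -> : g1 x1 *m Y = c *m V.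
  by apply: (bij_inj f0_bij); rewrite -dY g1K.
by rewrite mulmxBr mulmx1 mulmxA addrC subrK.
Qed.

Section EquationalFlatness.
Variable R : pzRingType.

(** The equational criterion of flatness: each linear relation in M with
    coefficients in R is a consequence of relations in R. *)
Definition equationally_flat (M : lmodType R) : Prop :=
  forall n (r : 'I_n -> R) (y : 'I_n -> M), \sum_i r i *: y i = 0 ->
  exists k (a : 'I_n -> 'I_k -> R) (z : 'I_k -> M),
    (forall i, y i = \sum_l a i l *: z l) /\
    (forall l, \sum_i r i * a i l = 0).

(** By Lambek's theorem it suffices to check Baer's criterion for M^+.  A
    partial map G : R -> M^+ induces the assignment
    \sum r_i y_i |-> \sum x_i (y_i), for G r_i x_i.  It is well defined
    because a relation \sum r_i y_i = 0 comes from relations in R, to which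
    the functionality of G applies; any extension of it to a character e of M
    induces G. *)
Lemma equationally_flatP (M : lmodType R) : equationally_flat M -> flat M.
Proof.
move=> Meq; apply/ldual_injective_flat/baer_injective => G Glin Gfun.
pose H (m : M) (u : QZ) := exists s : seq (R * ldual M * M),
  [/\ {in s, forall p, G p.1.1 p.1.2}, m = \sum_(p <- s) p.1.1 *: p.2
    & u = \sum_(p <- s) pairing p.1.2 p.2].
have [|||h hP] := @character_extend M H.
- by exists [::]; rewrite !big_nil.
- move=> _ _ _ _ [s [sG -> ->]] [t [tG -> ->]].
  exists (s ++ [seq (p.1, - p.2) | p <- t]).
  rewrite !big_cat !big_map /=; split.
  + by move=> p; rewrite mem_cat => /orP[/sG//|/mapP[q /tG Gq ->]].
  + by congr (_ + _); rewrite -sumrN; apply: eq_bigr => p _; rewrite scalerN.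
  + by congr (_ + _); rewrite -sumrN; apply: eq_bigr => p _; rewrite raddfN.
- move=> _ [s [sG + ->]]; rewrite !(big_tnth _ _ s).
  move=> /esym/Meq[k [a [z [yE ra0]]]].
  have sG' i : G (tnth (in_tuple s) i).1.1 (tnth (in_tuple s) i).1.2.
    by apply: sG; rewrite mem_tnth.
  under eq_bigr => i _ do rewrite yE raddf_sum.
  rewrite exchange_big big1 //= => l _.
  pose u := \sum_i (a i l : R^c) *: (tnth (in_tuple s) i).1.2.
  have u0 : u = 0.
    apply: Gfun; rewrite -(ra0 l).
    exact: (linear_rel_sum _ (fun i => a i l : R^c) Glin sG').
  rewrite -[RHS](pairing0l (z l)) -u0 /u.
  elim/big_rec2: _ => [|i v w _ ->]; first by rewrite pairing0l.
  by rewrite pairingDl ldualZ.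
have [e eE] := exists_character (raddfD h).
exists e => r u Gru; apply: pairing_ext => m.
rewrite ldualZ eE; apply: hP; exists [:: ((r : R), u, m)].
by rewrite !big_seq1; split=> // p; rewrite inE => /eqP ->.
Qed.

(** The equational criterion for E^+.  Given \sum r_i y_i = 0 in E^+, let the
    rows of a generate the relations between the r_i.  A tuple e in E^n
    killed by a defines a partial map r_i |-> e_i from R to E, so e_i = r_i e0
    for some e0 as E is injective, and \sum y_i (e_i) = 0.  Thus the
    character (y_i) of E^n vanishes on the kernel of a : E^n -> E^k, so it
    factors as X o a with X a character of E^k; the components z of X satisfy
    y = a z. *)
Lemma coherent_rdual_flat (E : rmodType R) :
  right_coherent R -> injective_module E -> flat (rdual E).
Proof.
move=> coh /injective_baer Ebaer; apply: equationally_flatP => n r y ry0.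
pose rc : 'cV[R^c]_n := \col_i r i.
have [k [a [ar0 a_all]]] := coherent_relations coh rc.
pose al (e : {ffun 'I_n -> E}) : {ffun 'I_k -> E} :=
  [ffun l => \sum_i a l i *: e i].
pose Psi (e : {ffun 'I_n -> E}) := \sum_i pairing (y i) (e i).
have alB : zmod_morphism al.
  move=> e f; apply/ffunP => l; rewrite !ffunE -sumrB; apply: eq_bigr => i _.
  by rewrite !ffunE scalerBr.
have PsiB : zmod_morphism Psi.
  by move=> e f; rewrite -sumrB; apply: eq_bigr => i _; rewrite !ffunE raddfB.
have [e /= ale|X XE] :=
    @character_extend_inj _ _ (additive_of alB) (additive_of PsiB).
  pose G (x : R^c^o) (u : E) := exists c : 'rV[R^c]_n,
    x = (c *m rc) 0 0 /\ u = \sum_i c 0 i *: e i.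
  have Glin : linear_rel G.
    split=> [|b _ _ _ _ [c [-> ->]] [d [-> ->]]].
      exists 0; rewrite mul0mx mxE; split=> //.
      by rewrite big1 // => i _; rewrite mxE scale0r.
    exists (b *: c + d); split.
      by rewrite mulmxDl -scalemxAl [RHS]mxE [X in _ = X + _]mxE.
    rewrite scaler_sumr -big_split; apply: eq_bigr => i _ /=.
    by rewrite !mxE scalerDl scalerA.
  have Gfun : functional_rel G.
    move=> _ [c [cr ->]]; have /a_all[b ->] : c *m rc = 0.
      by apply/matrixP => i j; rewrite !ord1 -cr mxE.
    under eq_bigr => i _ do rewrite mxE scaler_suml.
    rewrite exchange_big big1 //= => l _.
    under eq_bigr => i _ do rewrite -scalerA.
    rewrite -scaler_sumr; have := congr1 (fun f : {ffun _} => f l) ale.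
    by rewrite !ffunE => ->; rewrite scaler0.
  have [e0 e0P] := Ebaer G Glin Gfun.
  have eE i : e i = (r i : R^c) *: e0.
    apply: e0P; exists (delta_mx 0 i); rewrite -rowE !mxE; split=> //.
    rewrite (bigD1 i) //= big1 ?addr0 ?mxE ?eqxx ?scale1r // => j ji.
    by rewrite mxE (negPf ji) andbF scale0r.
  rewrite /Psi; transitivity (pairing (\sum_i r i *: y i) e0).
    elim/big_rec2: _ => [|i u f _ ->]; first by rewrite pairing0l.
    by rewrite pairingDl rdualZ eE.
  by rewrite ry0 pairing0l.
pose single q (i : 'I_q) (e : E) : {ffun 'I_q -> E} :=
  [ffun j => if j == i then e else 0].
have singleD q i : {morph @single q i : u v / u + v}.
  by move=> u v; apply/ffunP => j; rewrite !ffunE; case: eqP; rewrite ?addr0.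
have /choice[z zE] : forall l, exists z : rdual E,
    pairing z =1 (fun e => X (single k l e)).
  by move=> l; apply: exists_character => u v; rewrite singleD raddfD.
exists k, (fun i l => a l i), z; split=> [i|l]; last first.
  have := congr1 (fun A => fun_of_matrix A l 0) ar0; rewrite [LHS]mxE [RHS]mxE.
  by apply: etrans; apply: eq_bigr => i _; rewrite mxE.
apply: pairing_ext => e.
have -> : pairing (y i) e = Psi (single n i e).
  rewrite /Psi (bigD1 i) //= big1 ?addr0 ?ffunE ?eqxx // => j ji.
  by rewrite ffunE (negPf ji) raddf0.
rewrite -[Psi _]/(additive_of PsiB _) -XE /=.
have -> : al (single n i e) = \sum_l single k l (a l i *: e).
  apply/ffunP => l; rewrite sum_ffunE ffunE (bigD1 i) //= big1 ?addr0.
    rewrite (bigD1 l) //= big1 ?addr0 ?ffunE ?eqxx // => j jl.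
    by rewrite ffunE eq_sym (negPf jl).
  by move=> j ji; rewrite ffunE (negPf ji) scaler0.
rewrite raddf_sum; elim/big_rec2: _ => [|l u f _ ->].
  by rewrite pairing0l.
by rewrite pairingDl rdualZ zE.
Qed.

End EquationalFlatness.

(** * Vanishing of Tor and a coinductive criterion for Gorenstein flatness *)
(** A 3 x 3 diagram chase with the bottom right corner missing.  Applied to
    the tensor product of two short exact sequences, it transfers injectivity
    between the two variables, which is the balance of Tor_1. *)
Lemma grid_chase (A1 A2 A3 B1 B2 B3 C1 C2 : zmodType)
    (u1 : {additive A1 -> A2}) (u2 : {additive A2 -> A3})
    (v1 : {additive B1 -> B2}) (v2 : {additive B2 -> B3})
    (w1 : {additive C1 -> C2})
    (a1 : {additive A1 -> B1}) (a2 : {additive A2 -> B2})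
    (a3 : {additive A3 -> B3})
    (b1 : {additive B1 -> C1}) (b2 : {additive B2 -> C2}) :
    (forall x, a2 (u1 x) = v1 (a1 x)) -> (forall x, a3 (u2 x) = v2 (a2 x)) ->
    (forall x, b2 (v1 x) = w1 (b1 x)) ->
    exact_at u1 u2 -> surj u2 -> exact_at v1 v2 ->
    exact_at a1 b1 -> exact_at a2 b2 -> injective w1 -> injective a2 ->
  injective a3.
Proof.
move=> au1 au2 bv u12 u2s v12 ab1 ab2 w1i a2i; apply: injective_ker => x.
have [y <-] := u2s x; rewrite au2 => /v12[z zy].
have /(ker_injective w1i)/ab1[v vz] : w1 (b1 z) = 0.
  by rewrite -bv zy; apply/ab2; exists y.
by apply/u12; exists v; apply: a2i; rewrite au1 vz.
Qed.

Section Tor.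
Variable R : pzRingType.
Implicit Types (A J Q : rmodType R) (K L M N F : lmodType R).

(** Tor_1(J, M) = 0. *)
Definition tor1_zero J M : Prop :=
  forall A Q (i : {linear A -> Q}) (p : {linear Q -> J}),
    short_exact i p -> injective (tmapl M i).

(** Flatness of the right module Q. *)
Definition rflat Q : Prop := forall M N (f : {linear M -> N}),
  injective f -> injective (tmapr Q f).

Lemma exists_left_cover M :
  exists K F (f : {linear K -> F}) (g : {linear F -> M}),
    short_exact f g /\ flat F.
Proof.
have [F [g [e [c [gs ec]]]]] := exists_free_cover M.
have [K [f [fi fg]]] := exists_kernel g.
exists K, F, f, g; split=> //.
by apply: flatP => A B i; apply: dual_basis_lflat ec.
Qed.

Lemma exists_right_cover J :
  exists A Q (i : {linear A -> Q}) (p : {linear Q -> J}),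
    short_exact i p /\ rflat Q.
Proof.
have [Q [p [e [c [ps ec]]]]] := exists_free_cover J.
have [A [i [ii ip]]] := exists_kernel p.
exists A, Q, i, p; split=> //.
by move=> M N f; apply: dual_basis_rflat ec.
Qed.

Lemma tmap_swap A Q M N (i : {linear A -> Q}) (f : {linear M -> N}) x :
  tmapl N i (tmapr A f x) = tmapr Q f (tmapl M i x).
Proof. exact: tensor_map_square. Qed.

(** With [left_of_right_cover] this says that Tor_1(J, M) = 0 can be tested
    on one surjection from a flat module onto either variable, and then holds
    for all. *)
Lemma tor1_of_flat_cover J K F M (f : {linear K -> F}) (g : {linear F -> M}) :
  short_exact f g -> flat F -> injective (tmapr J f) -> tor1_zero J M.
Proof.
move=> [fi fg gs] Fflat Jf A Q i p [ii ip ps].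
apply: (@grid_chase _ _ _ _ _ _ _ _ (tmapr A f) (tmapr A g) (tmapr Q f)
  (tmapr Q g) (tmapr J f) (tmapl K i) (tmapl F i) (tmapl M i)
  (tmapl K p) (tmapl F p)) => //; try exact: tmap_swap.
- exact: tmapr_exact.
- exact: tensor_map_surj (@idfun_surj A) gs.
- exact: tmapr_exact.
- exact: tmapl_exact.
- exact: tmapl_exact.
- exact: flat_inj.
Qed.

Lemma left_of_right_cover A Q J K N M (i : {linear A -> Q})
    (p : {linear Q -> J}) (f : {linear K -> N}) (g : {linear N -> M}) :
  short_exact i p -> rflat Q -> injective (tmapl M i) -> short_exact f g ->
  injective (tmapr J f).
Proof.
move=> [ii ip ps] Qflat Mi [fi fg gs].
apply: (@grid_chase _ _ _ _ _ _ _ _ (tmapl K i) (tmapl K p) (tmapl N i)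
  (tmapl N p) (tmapl M i) (tmapr A f) (tmapr Q f) (tmapr J f)
  (tmapr A g) (tmapr Q g)) => //; try by move=> x; exact/esym/tmap_swap.
- exact: tmapl_exact.
- exact: tensor_map_surj ps (@idfun_surj K).
- exact: tmapl_exact.
- exact: tmapr_exact.
- exact: tmapr_exact.
- exact: Qflat.
Qed.

Lemma tor1_of_right_cover A Q J M (i : {linear A -> Q}) (p : {linear Q -> J}) :
  short_exact i p -> rflat Q -> injective (tmapl M i) -> tor1_zero J M.
Proof.
move=> ip Qflat Mi; have [K [F [f [g [fg Fflat]]]]] := exists_left_cover M.
exact: tor1_of_flat_cover fg Fflat (left_of_right_cover ip Qflat Mi fg).
Qed.

Lemma tor1_zero_left J K N M (f : {linear K -> N}) (g : {linear N -> M}) :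
  tor1_zero J M -> short_exact f g -> injective (tmapr J f).
Proof.
move=> JM fg; have [A [Q [i [p [ip Qflat]]]]] := exists_right_cover J.
exact: left_of_right_cover ip Qflat (JM _ _ _ _ ip) fg.
Qed.

Lemma flat_tor1 M : flat M <-> forall J, tor1_zero J M.
Proof.
split=> [Mflat J A Q i p [ii _ _]|Mtor]; first exact: flat_inj.
apply: flatP => A Q i ii; apply: (Mtor _ _ _ i (coker_proj i)).
by split; [| exact: coker_exact | exact: coker_surj].
Qed.

(** The exactness of Tor_1(J, L) -> Tor_1(J, M) -> Tor_1(J, N). *)
Lemma tor1_zero_ext J L M N (f : {linear L -> M}) (g : {linear M -> N}) :
  short_exact f g -> tor1_zero J L -> tor1_zero J N -> tor1_zero J M.
Proof.
move=> [fi fg gs] JL JN.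
have [A [Q [i [p [ip Qflat]]]]] := exists_right_cover J.
apply: (tor1_of_right_cover ip Qflat); apply: injective_ker => x ix.
have /(ker_injective (JN _ _ _ _ ip)) : tmapl N i (tmapr A g x) = 0.
  by rewrite /= tmap_swap ix raddf0.
move=> /(tmapr_exact fg gs)[y yx].
suff y0 : y = 0 by rewrite -yx y0 raddf0.
apply: (ker_injective (JL _ _ _ _ ip)); apply: (ker_injective (Qflat _ _ f fi)).
by rewrite /= -tmap_swap yx.
Qed.

Lemma flat_ext L M N (f : {linear L -> M}) (g : {linear M -> N}) :
  short_exact f g -> flat L -> flat N -> flat M.
Proof.
move=> fg /flat_tor1 Lf /flat_tor1 Nf; apply/flat_tor1 => J.
exact: tor1_zero_ext fg (Lf J) (Nf J).
Qed.

Section DimensionShift.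
Variables (A Q J : rmodType R) (K F M : lmodType R).
Variables (i : {linear A -> Q}) (p : {linear Q -> J}).
Variables (f : {linear K -> F}) (g : {linear F -> M}).
Hypotheses (ip : short_exact i p) (Qflat : rflat Q).
Hypotheses (fg : short_exact f g) (Fflat : flat F).

(** Tor_1(A, M) and Tor_1(J, K) are both equal to Tor_2(J, M). *)
Lemma tor1_shift : tor1_zero A M <-> tor1_zero J K.
Proof.
have [ii _ _] := ip; have [fi _ _] := fg.
split=> [AM|JK].
  apply: (tor1_of_right_cover ip Qflat); apply: injective_ker => x ix.
  apply: (ker_injective (tor1_zero_left AM fg)).
  apply: (ker_injective (flat_inj Fflat ii)).
  by rewrite /= tmap_swap ix raddf0.
apply: (tor1_of_flat_cover fg Fflat); apply: injective_ker => x fx.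
apply: (ker_injective (JK _ _ _ _ ip)).
apply: (ker_injective (Qflat fi)).
by rewrite /= -tmap_swap fx raddf0.
Qed.

End DimensionShift.

(** Syzygies of modules satisfying P: vanishing of Tor_{n+1}(J, M) for all J
    in P becomes vanishing of Tor_1 at the n-th syzygies. *)
Inductive syzygy (P : rmodType R -> Prop) : nat -> rmodType R -> Prop :=
| Syzygy0 J : P J -> syzygy P 0 J
| SyzygyS n A Q J (i : {linear A -> Q}) (p : {linear Q -> J}) :
    short_exact i p -> rflat Q -> syzygy P n J -> syzygy P n.+1 A.

Definition tor_acyclic M : Prop :=
  forall n J, syzygy (@injective_module R^c) n J -> tor1_zero J M.

Lemma tor_acyclic_ext L M N (f : {linear L -> M}) (g : {linear M -> N}) :
  short_exact f g -> tor_acyclic L -> tor_acyclic N -> tor_acyclic M.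
Proof.
move=> fg TL TN n J nJ.
exact: tor1_zero_ext fg (TL n J nJ) (TN n J nJ).
Qed.

Lemma flat_tor_acyclic M : flat M -> tor_acyclic M.
Proof. by move=> /flat_tor1 Mf n J _; apply: Mf. Qed.

Lemma tor_acyclic_syzygy K F M (f : {linear K -> F}) (g : {linear F -> M}) :
  short_exact f g -> flat F -> tor_acyclic M -> tor_acyclic K.
Proof.
move=> fg Fflat TM n J nJ.
have [A [Q [i [p [ip Qflat]]]]] := exists_right_cover J.
apply/(tor1_shift ip Qflat fg Fflat)/(TM n.+1); exact: SyzygyS ip Qflat nJ.
Qed.

End Tor.

Lemma splice_exact (X A Y B Z : zmodType) (p : X -> A) (i : A -> Y) (q : Y -> B)
    (j : {additive B -> Z}) (f : X -> Y) (g : Y -> Z) :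
  (forall x, f x = i (p x)) -> (forall y, g y = j (q y)) ->
  surj p -> exact_at i q -> injective j -> exact_at f g.
Proof.
move=> fE gE ps iq ji y; rewrite gE.
split=> [/(ker_injective ji)/iq[a <-]|[x <-]].
  by have [x <-] := ps a; exists x; rewrite fE.
by rewrite fE (_ : q _ = 0) ?raddf0 //; apply/iq; eexists.
Qed.

Section GorensteinFlat.
Variable R : pzRingType.
Implicit Types (A J Q : rmodType R) (K L M N F : lmodType R).

Record flat_step M M' := FlatStep {
  mid : lmodType R;
  inc : {linear M -> mid};
  quo : {linear mid -> M'};
  mid_flat : flat mid;
  step_exact : short_exact inc quo }.

Lemma tmapr_step (I : rmodType R) M M' (s : flat_step M M') :
  tor1_zero I M' -> short_exact (tmapr I (inc s)) (tmapr I (quo s)).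
Proof.
have ex := step_exact s; have [_ iq qs] := ex; split.
- exact: tor1_zero_left ex.
- exact: tmapr_exact.
- exact: tensor_map_surj (@idfun_surj I) qs.
Qed.

Lemma inhabited_elim (T : Type) : inhabited T -> T.
Proof.
move=> T_inh.
by have [x _] := cid (let: inhabits x := T_inh in ex_intro xpredT x isT).
Qed.

(** Gorenstein flat modules form the largest class of Tor-acyclic modules in
    which every module embeds in a flat module with cokernel in the class.
    Both halves of the complete resolution are obtained by dependent choice
    and spliced. *)
Lemma gorenstein_flat_coind (X : lmodType R -> Prop) :
    (forall M, X M -> tor_acyclic M) ->
    (forall M, X M -> exists M', X M' /\ inhabited (flat_step M M')) ->
  forall M, X M -> gorenstein_flat M.
Proof.
move=> XT Xstep M XM.
have right_step (x : {N | X N}) :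
    {y : {N | X N} & flat_step (sval x) (sval y)}.
  case: x => N XN; have /cid[N' [XN' s]] := Xstep N XN.
  by exists (exist _ N' XN'); apply: inhabited_elim.
have left_step (x : {N : lmodType R | tor_acyclic N}) :
    {y : {N | tor_acyclic N} & flat_step (sval y) (sval x)}.
  case: x => N TN.
  have /cid[K [TK s]] : exists K, tor_acyclic K /\ inhabited (flat_step K N).
    have [K [F [f [g [fg Fflat]]]]] := exists_left_cover N.
    exists K; split; first exact: tor_acyclic_syzygy fg Fflat TN.
    exact: inhabits (FlatStep Fflat fg).
  by exists (exist _ K TK); apply: inhabited_elim.
pose C n := iter n (fun x => projT1 (right_step x)) (exist _ M XM).
pose K n := iter n (fun x => projT1 (left_step x)) (exist _ M (XT M XM)).
pose s n : flat_step (sval (C n)) (sval (C n.+1)) := projT2 (right_step (C n)).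
pose r n : flat_step (sval (K n.+1)) (sval (K n)) := projT2 (left_step (K n)).
pose L n := mid (r n); pose U n := mid (s n).
pose l n : {linear L n.+1 -> L n} := inc (r n) \o quo (r n.+1).
pose t : {linear L 0%N -> U 0%N} := inc (s 0%N) \o quo (r 0%N).
pose u n : {linear U n -> U n.+1} := inc (s n.+1) \o quo (s n).
exists L, U, l, t, u; split.
- by split=> n; apply: mid_flat.
- have rE n := step_exact (r n); have sE n := step_exact (s n).
  have r_surj n : surj (quo (r n)) by case: (rE n).
  have s_surj n : surj (quo (s n)) by case: (sE n).
  have r_inj n : injective (inc (r n)) by case: (rE n).
  have s_inj n : injective (inc (s n)) by case: (sE n).
  have r_ex n : exact_at (inc (r n)) (quo (r n)) by case: (rE n).
  have s_ex n : exact_at (inc (s n)) (quo (s n)) by case: (sE n).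
  split=> [n|||n].
  + by apply: (splice_exact _ _ (r_surj n.+2) (r_ex n.+1) (r_inj n)).
  + by apply: (splice_exact _ _ (r_surj 1%N) (r_ex 0%N) (s_inj 0%N)).
  + by apply: (splice_exact _ _ (r_surj 0%N) (s_ex 0%N) (s_inj 1%N)).
  + by apply: (splice_exact _ _ (s_surj n) (s_ex n.+1) (s_inj n.+2)).
- exists (inc (s 0%N)); have [si _ _] := step_exact (s 0%N); split=> // y.
  have [_ _ qs] := step_exact (r 0%N).
  split=> [[x <-]|[x <-]]; last by exists (quo (r 0%N) x).
  by have [z <-] := qs x; exists z.
- move=> I Iinj.
  have rE n := tmapr_step (r n) (svalP (K n) 0%N I (Syzygy0 Iinj)).
  have sE n := tmapr_step (s n) (XT _ (svalP (C n.+1)) 0%N I (Syzygy0 Iinj)).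
  have r_surj n : surj (tmapr I (quo (r n))) by case: (rE n).
  have s_surj n : surj (tmapr I (quo (s n))) by case: (sE n).
  have r_inj n : injective (tmapr I (inc (r n))) by case: (rE n).
  have s_inj n : injective (tmapr I (inc (s n))) by case: (sE n).
  have r_ex n : exact_at (tmapr I (inc (r n))) (tmapr I (quo (r n))).
    by case: (rE n).
  have s_ex n : exact_at (tmapr I (inc (s n))) (tmapr I (quo (s n))).
    by case: (sE n).
  have comp (M1 M2 M3 : lmodType R) (f : {linear M2 -> M3})
      (g : {linear M1 -> M2}) x :
      tmapr I (f \o g) x = tmapr I f (tmapr I g x).
    by apply/esym; apply: tensor_map_comp.
  split=> [n|||n].
  + by apply: (splice_exact (comp _ _ _ _ _) (comp _ _ _ _ _)
      (r_surj n.+2) (r_ex n.+1) (r_inj n)).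
  + by apply: (splice_exact (comp _ _ _ _ _) (comp _ _ _ _ _)
      (r_surj 1%N) (r_ex 0%N) (s_inj 0%N)).
  + by apply: (splice_exact (comp _ _ _ _ _) (comp _ _ _ _ _)
      (r_surj 0%N) (s_ex 0%N) (s_inj 1%N)).
  + by apply: (splice_exact (comp _ _ _ _ _) (comp _ _ _ _ _)
      (s_surj n) (s_ex n.+1) (s_inj n.+2)).
Qed.

End GorensteinFlat.

(** * Extensions of Gorenstein flat modules *)
Section ShiftedComplexes.
Variable R : pzRingType.

(** A complete resolution is cut at some place into L and U; moving the cut by
    one place lengthens one half by a term. *)
Definition cons_module (V : lmodType R) (U : nat -> lmodType R) (n : nat) :
  lmodType R := if n is m.+1 then U m else V.

Definition cons_up (V : lmodType R) (U : nat -> lmodType R)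
    (t : {linear V -> U 0%N}) (u : forall n, {linear U n -> U n.+1}) n :
    {linear cons_module V U n -> cons_module V U n.+1} :=
  match n with 0%N => t | m.+1 => u m end.

Definition cons_down (V : lmodType R) (L : nat -> lmodType R)
    (t : {linear L 0%N -> V}) (l : forall n, {linear L n.+1 -> L n}) n :
    {linear cons_module V L n.+1 -> cons_module V L n} :=
  match n with 0%N => t | m.+1 => l m end.

End ShiftedComplexes.

Section GFClosed.
Variable R : pzRingType.
Implicit Types (F G K L M N : lmodType R).

(** The complete resolution of M, cut one place further left, is one of
    K = Ker (L_0 -> U_0). *)
Lemma gorenstein_flat_syzygy M : gorenstein_flat M ->
  exists K F (f : {linear K -> F}) (g : {linear F -> M}),
    [/\ short_exact f g, flat F, gorenstein_flat K
      & forall I : rmodType R, injective_module I -> injective (tmapr I f)].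
Proof.
move=> [L [U [l [t [u [[Lf Uf] [lE ltE tuE uE] [j [ji jt]] IE]]]]]].
have [K [k [ki kt]]] := exists_kernel t.
have [|g gE] := factor_inj (h := t) ji.
  by move=> x; apply/jt; exists x.
have kg : short_exact k g.
  split=> // y; last by have [x tx] := (jt (j y)).1 (ex_intro _ y erefl);
    exists x; apply: ji; rewrite gE.
  split=> [gy|/kt ty]; last by apply: ji; rewrite gE ty raddf0.
  by apply/kt; rewrite -gE gy raddf0.
exists K, (L 0%N), k, g; split=> //.
- exists (fun n => L n.+1), (cons_module (L 0%N) U), (fun n => l n.+1), (l 0%N),
    (cons_up t u); split.
  + by split=> [n|[|n]] /=.
  + by split=> [n|||[|n]] /=.
  + exists k; split=> // y; split=> [[x xy]|[x xy]].
      by apply/ltE/kt; exists x.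
    by apply/kt/ltE; exists x.
  + move=> I Iinj; have [IlE IltE ItuE IuE] := IE I Iinj.
    by split=> [n|||[|n]] /=.
- move=> I Iinj; have [IlE IltE ItuE IuE] := IE I Iinj.
  have [|m mE] := factor_inj (h := l 0%N) ki.
    by move=> x; apply/kt/ltE; exists x.
  have ms : surj m.
    move=> x; have /ltE[y yx] : t (k x) = 0 by apply/kt; exists x.
    by exists y; apply: ki; rewrite mE.
  have kmE y : tmapr I k (tmapr I m y) = tmapr I (l 0%N) y.
    exact: tensor_map_comp.
  apply: injective_ker => x kx.
  have [y yx] := tensor_map_surj (@idfun_surj I) ms x.
  move: kx; rewrite -yx /= kmE => /IlE[z <-].
  rewrite (tensor_map_comp (h := idfun) (k := \0)) ?tensor_map_eq0 //=;
    last first.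
    by move=> w; apply: ki; rewrite mE raddf0; apply/lE; exists w.
  by right.
Qed.

(** The complete resolution of M, cut one place further right, is one of the
    cokernel of M -> U_0, which embeds in U_1. *)
Lemma gorenstein_flat_cosyzygy M : gorenstein_flat M ->
  exists M', gorenstein_flat M' /\ inhabited (flat_step M M').
Proof.
move=> [L [U [l [t [u [[Lf Uf] [lE ltE tuE uE] [j [ji jt]] IE]]]]]].
exists (coker j); split; last first.
  apply: inhabits; apply: (@FlatStep _ _ _ _ j (coker_proj j)) => //.
  by split=> //; [apply: coker_exact | apply: coker_surj].
have [|q qE] := factor_surj (h := u 0%N) (@coker_surj _ _ _ j).
  by move=> x /coker_exact xj; apply/tuE/jt.
exists (cons_module (U 0%N) L), (fun n => U n.+1), (cons_down t l), (u 0%N),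
  (fun n => u n.+1); split.
- by split=> [[|n]|n] /=.
- by split=> [[|n]|||n] /=.
- exists q; split.
    apply: injective_ker => y; have [x <-] := coker_surj y.
    by rewrite /= qE => /tuE/jt xj; apply/coker_exact.
  move=> y; split=> [[z <-]|[x <-]]; last by exists (coker_proj j x).
  by have [x <-] := coker_surj z; exists x.
- move=> I Iinj; have [IlE IltE ItuE IuE] := IE I Iinj.
  by split=> [[|n]|||n] /=.
Qed.

Lemma gorenstein_flat_tor_acyclic M : gorenstein_flat M -> tor_acyclic M.
Proof.
move=> + n J nJ; elim: nJ M => {n J} [I Iinj|n A Q J i p ip Qflat _ IHJ] M GM.
  have [K [F [f [g [fg Fflat _ If]]]]] := gorenstein_flat_syzygy GM.
  exact: tor1_of_flat_cover fg Fflat (If I Iinj).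
have [K [F [f [g [fg Fflat GK _]]]]] := gorenstein_flat_syzygy GM.
exact/(tor1_shift ip Qflat fg Fflat)/IHJ.
Qed.

Lemma zero_flat M : (forall x : M, x = 0) -> flat M.
Proof.
move=> M0; apply: flatP => A B i _; apply: injective_ker => x _.
elim/tensor_elim: x => // a m x ->.
by rewrite (M0 m) tens0r addr0.
Qed.

Lemma flat_gorenstein_flat M : flat M -> gorenstein_flat M.
Proof.
apply: gorenstein_flat_coind => {}M; first exact: flat_tor_acyclic.
move=> Mflat; exists (coker (idfun : {linear M -> M})); split.
  apply: zero_flat => x; have [y <-] := coker_surj x.
  by apply/coker_exact; exists y.
apply: inhabits; apply: (@FlatStep _ _ _ M idfun (coker_proj _)) => //.
by split=> //; [apply: coker_exact | apply: coker_surj].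
Qed.

Lemma syzygyS_inv (P : rmodType R -> Prop) n A : syzygy P n.+1 A ->
  exists (Q J : rmodType R) (i : {linear A -> Q}) (p : {linear Q -> J}),
    [/\ short_exact i p, rflat Q & syzygy P n J].
Proof.
suff main m : syzygy P m A -> if m is n'.+1 then
    exists (Q J : rmodType R) (i : {linear A -> Q}) (p : {linear Q -> J}),
      [/\ short_exact i p, rflat Q & syzygy P n' J] else True.
  exact: (main n.+1).
by case=> // {}m {}A Q J i p ip Qflat mJ; exists Q, J, i, p.
Qed.

(** For fd M <= n, Tor_{n+1}(-, M) = 0: induction on n by dimension
    shifting. *)
Lemma flat_dim_le_tor1 n M : flat_dim_le n M ->
  forall A, syzygy (fun _ : rmodType R => True) n A -> tor1_zero A M.
Proof.
elim: n M => [|n IHn] M [F [d [p [[Fflat F0] dE dpE ps]]]] A nA.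
  have d0 x : p x = 0 -> x = 0.
    by move=> /dpE[y <-]; rewrite (F0 1%N isT y) linear0.
  have [K [k [ki kp]]] := exists_kernel p.
  apply: (@tor1_of_flat_cover _ _ K (F 0%N) _ k p) => //.
  apply: injective_ker => x _; elim/tensor_elim: x => // a m x ->.
  have -> : m = 0 by apply: ki; rewrite raddf0; apply/d0/kp; exists m.
  by rewrite tens0r addr0.
have [K [k [ki kp]]] := exists_kernel p.
have kp_se : short_exact k p by [].
have [|q qE] := factor_inj (h := d 0%N) ki.
  by move=> x; apply/kp/dpE; exists x.
have Kdim : flat_dim_le n K.
  exists (fun i => F i.+1), (fun i => d i.+1), q; split=> [|i|y|x].
  - by split=> // i ni; apply: F0.
  - exact: dE.
  - rewrite -(dE 0%N y) -qE; split=> [->|qy]; first by rewrite raddf0.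
    by apply: ki; rewrite qy raddf0.
  - have /dpE[y yx] : p (k x) = 0 by apply/kp; exists x.
    by exists y; apply: ki; rewrite qE.
have [Q [J [i [r [ir Qflat nJ]]]]] := syzygyS_inv nA.
exact/(tor1_shift ir Qflat kp_se (Fflat 0%N))/IHn.
Qed.

(** If Tor_{n+1} vanishes on Gorenstein flat modules, it does so on the n-th
    cosyzygy of M, hence Tor_1 vanishes on M. *)
Lemma gorenstein_flat_shift n M : gorenstein_flat M ->
    (forall N, gorenstein_flat N -> forall A,
       syzygy (fun _ : rmodType R => True) n A -> tor1_zero A N) ->
  flat M.
Proof.
elim: n M => [|n IHn] M GM Hn.
  by apply/flat_tor1 => J; apply: Hn => //; constructor.
apply: IHn GM _ => N GN J nJ.
have [N' [GN' [s]]] := gorenstein_flat_cosyzygy GN.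
have [A [Q [i [p [ip Qflat]]]]] := exists_right_cover J.
apply/(tor1_shift ip Qflat (step_exact s) (mid_flat s))/Hn => //.
exact: SyzygyS ip Qflat nJ.
Qed.

Lemma finite_weak_dim_gorenstein_flat M :
  finite_weak_dim R -> gorenstein_flat M -> flat M.
Proof.
move=> [n dimR] GM; apply: (gorenstein_flat_shift (n := n)) GM _ => N _.
exact: flat_dim_le_tor1.
Qed.

Lemma finite_weak_dim_GF_closed : finite_weak_dim R -> left_GF_closed R.
Proof.
move=> dimR A B C f g fg GA GC; apply: flat_gorenstein_flat.
by apply: flat_ext fg _ _; apply: finite_weak_dim_gorenstein_flat.
Qed.

(** Purity of f means that Tor_1(J, M) -> Tor_1(J, N) is onto for all J. *)
Lemma pure_quotient_flat L M N (f : {linear L -> M}) (g : {linear M -> N}) :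
    short_exact f g -> flat M ->
    (forall J : rmodType R, injective (tmapr J f)) -> flat N.
Proof.
move=> fg Mflat pure_f; apply/flat_tor1 => J.
exact: tor1_of_flat_cover fg Mflat (pure_f J).
Qed.

(** 0 -> F/A -> G/A -> G/F -> 0. *)
Lemma nested_coker (A F G A' : lmodType R) (i : {linear A -> F})
    (p : {linear F -> A'}) (j : {linear F -> G}) :
    short_exact i p -> injective j ->
  exists (a : {linear A' -> coker (j \o i)})
         (b : {linear coker (j \o i) -> coker j}), short_exact a b.
Proof.
move=> [ii ip ps] ji.
have [|a aE] := factor_surj (h := coker_proj (j \o i) \o j) ps.
  by move=> x /ip[y <-]; apply/coker_exact; exists y.
have [|b bE] := factor_surj (h := coker_proj j) (@coker_surj _ _ _ (j \o i)).
  by move=> x /coker_exact[y <-]; apply/coker_exact; exists (i y).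
exists a, b; split.
- apply: injective_ker => y; have [x <-] := ps y.
  rewrite /= aE => /coker_exact[z /ji <-]; apply/ip; by exists z.
- move=> y; have [x <-] := coker_surj y; rewrite bE.
  split=> [/coker_exact[z <-]|[z]]; first by exists (p z); rewrite aE.
  have [w <-] := ps z; rewrite aE /= => bw.
  have := congr1 b bw; rewrite !bE => /esym xw; apply: (etrans xw).
  by apply/coker_exact; exists w.
- by move=> y; have [x <-] := coker_surj y; exists (coker_proj _ x).
Qed.

(** The usual horseshoe lemma for injective resolutions: all it requires of G
    is the extension e of iA to B. *)
Lemma horseshoe (A B C G A' F C' : lmodType R) (f : {linear A -> B})
    (g : {linear B -> C}) (iA : {linear A -> G}) (pA : {linear G -> A'})
    (iC : {linear C -> F}) (pC : {linear F -> C'}) (e : {linear B -> G}) :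
    short_exact f g -> short_exact iA pA -> short_exact iC pC ->
    (forall x, e (f x) = iA x) ->
  exists (D : lmodType R) (j : {linear B -> (G * F)%type})
    (q : {linear (G * F)%type -> D})
    (a : {linear A' -> D}) (c : {linear D -> C'}),
    short_exact j q /\ short_exact a c.
Proof.
move=> [fi fg gs] [iAi iAp pAs] [iCi iCp pCs] ef.
have jlin : linear (fun b => (e b, iC (g b)) : (G * F)%type).
  by move=> r x y; rewrite !linearP.
have inlin : linear (fun x => (x, 0) : (G * F)%type).
  by move=> r x y; congr (_, _); rewrite /= scaler0 addr0.
have outlin : linear (fun z : (G * F)%type => pC z.2).
  by move=> r x y; rewrite -linearP.
pose j := linear_of jlin; pose q := coker_proj j.
have [|a aE] := factor_surj (h := q \o linear_of inlin) pAs.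
  move=> x /iAp[y <-] /=; apply/coker_exact; exists (f y) => /=.
  have -> : g (f y) = 0 by apply/fg; exists y.
  by rewrite ef linear0.
have [|c cE] := factor_surj (h := linear_of outlin) (@coker_surj _ _ _ j).
  by move=> _ /coker_exact[b <-] /=; apply/iCp; exists (g b).
exists (coker j), j, q, a, c; split.
  split; [|exact: coker_exact|exact: coker_surj].
  apply: injective_ker => b [eb /(ker_injective iCi)/fg[x xb]].
  by rewrite -xb (_ : x = 0) ?linear0 //; apply: iAi; rewrite -ef xb eb linear0.
split.
- apply: injective_ker => y; have [x <-] := pAs y.
  rewrite /= aE => /coker_exact[b [eb /(ker_injective iCi)/fg[z zb]]].
  by apply/iAp; exists z; rewrite -ef zb.
- move=> d; have [[x y] <-] := coker_surj d; rewrite cE /=.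
  split=> [/iCp[z zy]|[z]].
    have [b bz] := gs z; exists (pA (x - e b)); rewrite aE /=.
    apply/coker_ofP; exists (- b) => /=; rewrite !linearN /= bz zy.
    by congr (_, _); rewrite /= ?sub0r // addrAC subrr add0r.
  have [w <-] := pAs z; rewrite aE /= => /coker_ofP[b [_ by_]].
  by apply/iCp; exists (- g b); rewrite linearN by_ sub0r opprK.
- move=> z; have [y <-] := pCs z; exists (q (0, y)); exact: cE.
Qed.

Inductive iterated_extension (X : lmodType R -> Prop) : lmodType R -> Prop :=
| IterExtBase M : X M -> iterated_extension X M
| IterExt L M N (f : {linear L -> M}) (g : {linear M -> N}) :
    short_exact f g -> iterated_extension X L -> iterated_extension X N ->
    iterated_extension X M.

Lemma prod_flat F G : flat F -> flat G -> flat (F * G)%type.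
Proof.
have inlin : linear (fun x => (x, 0) : (F * G)%type).
  by move=> r x y; congr (_, _); rewrite /= scaler0 addr0.
have outlin : linear (fun z : (F * G)%type => z.2) by move=> r x y.
apply: (flat_ext (f := linear_of inlin) (g := linear_of outlin)).
split; [by move=> x y [] | | by move=> y; exists (0, y)].
by move=> [x y]; split=> [/= ->|[z [_ <-]]] //; exists x.
Qed.

Lemma iterated_extension_tor_acyclic M :
  iterated_extension (@gorenstein_flat R) M -> tor_acyclic M.
Proof.
elim=> {M}; first exact: gorenstein_flat_tor_acyclic.
by move=> L M N f g fg _ TL _ TN; apply: tor_acyclic_ext fg TL TN.
Qed.

(** For an extension B of C by A, the embedding of A into the flat module
    F = mid sA becomes extendable to B after composing it with F -> G = F^++;
    purity keeps the cokernel of A -> G inside the class. *)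
Lemma iterated_extension_cosyzygy M : right_coherent R ->
  iterated_extension (@gorenstein_flat R) M -> exists M',
    iterated_extension (@gorenstein_flat R) M' /\ inhabited (flat_step M M').
Proof.
move=> coh.
elim=> {M} [M GM|A B C f g fg XA [A' [XA' [sA]]] XC [C' [XC' [sC]]]].
  have [M' [GM' s]] := gorenstein_flat_cosyzygy GM.
  by exists M'; split=> //; constructor.
have Iinj := flat_ldual_injective (mid_flat sA).
have Gflat := coherent_rdual_flat coh Iinj.
set I := ldual (mid sA) in Iinj Gflat.
have [ev evE] := exists_biduality (mid sA).
have ev_inj := biduality_injective evE.
have [a [b ab]] := nested_coker (step_exact sA) ev_inj.
have [sAi _ _] := step_exact sA.
have C_tor : tor1_zero I C.
  exact: (iterated_extension_tor_acyclic XC (Syzygy0 Iinj)).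
have [e eE] := rdual_extend (i := f) (ev \o inc sA) (tor1_zero_left C_tor fg).
have ip : short_exact (ev \o inc sA) (coker_proj (ev \o inc sA)).
  by split; [apply: inj_comp | apply: coker_exact | apply: coker_surj].
have [D [j [q [u [c [jq uc]]]]]] := horseshoe fg ip (step_exact sC) eE.
exists D; split; last first.
  exact: inhabits (FlatStep (prod_flat Gflat (mid_flat sC)) jq).
(* The cokernel D is an extension of C' by G/A, which is itself an
   extension of the flat module G/F by A'. *)
apply: IterExt uc _ XC'; apply: IterExt ab XA' _.
apply: IterExtBase; apply: flat_gorenstein_flat.
apply: (pure_quotient_flat (f := ev) (g := coker_proj ev)) => //.
  by split=> //; [apply: coker_exact | apply: coker_surj].
by move=> J; apply: biduality_pure.
Qed.

Lemma right_coherent_GF_closed : right_coherent R -> left_GF_closed R.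
Proof.
move=> coh A B C f g fg GA GC.
apply: (gorenstein_flat_coind (X := iterated_extension (@gorenstein_flat R))).
- exact: iterated_extension_tor_acyclic.
- by move=> M; apply: iterated_extension_cosyzygy.
- by apply: IterExt fg _ _; apply: IterExtBase.
Qed.

End GFClosed.

Theorem proposition2p2 :
  (forall R : pzRingType, right_coherent R -> left_GF_closed R) /\
  (forall R : pzRingType, finite_weak_dim R -> left_GF_closed R).
Proof.
split=> R; first exact: right_coherent_GF_closed.
exact: finite_weak_dim_GF_closed.
Qed.
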